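(* Any two balanced triangulations of the $2$-sphere, neither of which is the octahedral sphere, can be transformed into each other by a sequence of P-splittings and P-contractions.
   Context: A triangulation of a closed surface $F^2$ is a simple graph $G$ embedded on $F^2$ such that every face is bounded by a $3$-cycle and any two faces share at most one edge; a face on vertices $a,b,c$ is written $abc$. A triangulation is balanced if its graph is $3$-colorable. The octahedral sphere is the boundary of the cross $3$-polytope (the triangulation of the $2$-sphere with $6$ vertices, all of degree $4$). Operations are required to produce again a triangulation (no multiple edges created), and every triangle named is required to be a face. P-splitting: if a vertex $v$ lies in faces $vwx, vxy, vyz$ with $w,x,y,z$ distinct and $wz$ is not an edge, introduce a new vertex $u$ (colored as $v$), delete these three faces and the edges $vx, vy$, and add the five faces $vwz, uwz, uwx, uxy, uyz$. P-contraction: the inverse operation, i.e. if $u$ is a vertex of degree $4$ lying in faces $uwx, uxy, uyz, uzw$, and $vwz$ is a face with $v\neq u$ such that $vx$ and $vy$ are not edges, delete $u$ and the edge $wz$ and replace the five faces $uwx,uxy,uyz,uzw,vwz$ by $vwx, vxy, vyz$. *)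

(* Defs.v *)
From mathcomp Require Import all_boot.
From mathcomp Require Export finmap.
From Stdlib Require Export Relations.Relation_Operators.
Set Implicit Arguments.
Unset Strict Implicit.
Unset Printing Implicit Defensive.

Local Open Scope fset_scope.

(* Since any two faces share at most one edge, a face is determined by its
   three vertices; a triangulation is represented by the set of its faces, as a
   pure 2-dimensional simplicial complex with vertices labelled by naturals. *)
Definition complex := {fset {fset nat}}.

Definition vertices (K : complex) : {fset nat} := \bigcup_(f <- K) f.

Definition edges (K : complex) : {fset {fset nat}} :=
  \bigcup_(f <- K) [fset e in fpowerset f | #|` e| == 2].

Definition adj (K : complex) : rel nat := fun x y => [fset x; y] \in edges K.

Definition degree (K : complex) (v : nat) : nat :=
  #|` [fset x in vertices K | adj K v x]|.

(* The faces at v are v c_i c_(i+1) for a cycle c of length at least 3,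
   i.e. v has a disk neighbourhood. *)
Definition link_is_cycle (K : complex) (v : nat) : Prop :=
  exists c : seq nat,
    [/\ uniq c, 3 <= size c
      & forall f : {fset nat},
          (f \in K /\ v \in f) <->
          (exists2 x, x \in c & f = [fset v; x; next c x])].

Definition connected (K : complex) : Prop :=
  forall x y, x \in vertices K -> y \in vertices K ->
  exists2 p, path (adj K) x p & last x p = y.

(* Triangulations of (connected, nonempty) closed surfaces. *)
Definition triangulation (K : complex) : Prop :=
  [/\ K != fset0,
      forall f, f \in K -> #|` f| = 3,
      forall v, v \in vertices K -> link_is_cycle K v
    & connected K].

(* The 2-sphere is the closed surface with Euler characteristic
   V - E + F = 2. *)
Definition sphere_triangulation (K : complex) : Prop :=
  triangulation K /\ (#|` vertices K| + #|` K| = #|` edges K| + 2)%N.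

Definition balanced (K : complex) : Prop :=
  exists c : nat -> 'I_3, forall x y, adj K x y -> c x <> c y.

Definition isomorphic (K L : complex) : Prop :=
  exists f : nat -> nat,
    {in vertices K &, injective f} /\ L = [fset (f @` s)%fset | s : {fset nat} in K].

(* The antipodal pairs of the cross-polytope are {0,3}, {1,4} and {2,5}. *)
Definition octahedral_sphere : complex :=
  [fset [fset 0; 1; 2]; [fset 0; 1; 5]; [fset 0; 4; 2]; [fset 0; 4; 5];
        [fset 3; 1; 2]; [fset 3; 1; 5]; [fset 3; 4; 2]; [fset 3; 4; 5]].

Definition P_splitting (K L : complex) : Prop :=
  exists u v w x y z : nat,
    [/\ [/\ [fset v; w; x] \in K, [fset v; x; y] \in K & [fset v; y; z] \in K],
        uniq [:: w; x; y; z],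
        ~~ adj K w z,
        u \notin vertices K
      & L = (K `\` [fset [fset v; w; x]; [fset v; x; y]; [fset v; y; z]])
            `|` [fset [fset v; w; z]; [fset u; w; z]; [fset u; w; x];
                      [fset u; x; y]; [fset u; y; z]]]
    /\ triangulation L.

Definition P_contraction (K L : complex) : Prop :=
  exists u v w x y z : nat,
    [/\ [/\ [fset u; w; x] \in K, [fset u; x; y] \in K,
            [fset u; y; z] \in K & [fset u; z; w] \in K],
        degree K u = 4,
        [fset v; w; z] \in K /\ v <> u,
        ~~ adj K v x /\ ~~ adj K v y
      & L = (K `\` [fset [fset u; w; x]; [fset u; x; y]; [fset u; y; z];
                         [fset u; z; w]; [fset v; w; z]])
            `|` [fset [fset v; w; x]; [fset v; x; y]; [fset v; y; z]]]
    /\ triangulation L.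

Definition P_move (K L : complex) : Prop := P_splitting K L \/ P_contraction K L.

(* Triangulations are considered up to relabelling of the vertices. *)
Definition P_equivalent (K L : complex) : Prop :=
  exists2 K', clos_refl_trans complex P_move K K' & isomorphic K' L.

(* Main.v *)
From mathcomp Require Import all_boot zify.
From Stdlib Require Import Classical ClassicalEpsilon.
Require Import Defs.
Set Implicit Arguments.
Unset Strict Implicit.
Unset Printing Implicit Defensive.

(** Degrees in a balanced triangulation are even, so by Euler's formula a
    balanced sphere has vertices of degree 4. If [u] has degree 4 with link
    [a b c d], the P-contraction across the link edge [ab] is blocked only when
    the vertex [v] opposite to [u] is adjacent to [c] or [d], which creates a
    3-cycle [vbc] or [vad]. Every 3-cycle bounds a
    disk; take a smallest disk [S] with more than one face. If its boundary is
    not a face, and no contraction is possible, then every edge in the link of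
    an inner vertex of degree 4 has an end of the same kind, so the star of
    these vertices is closed and fills the sphere, which is absurd since it
    lies in [S]. Otherwise all 3-cycles are faces, and the same argument makes
    the triangulation a bipyramid over an even cycle. The bipyramid over a
    4-cycle is the octahedron; one splitting followed by two contractions
    reduces the bipyramids over cycles of length at least 8. By induction on
    the number of vertices everything is equivalent to the bipyramid over a
    hexagon. *)

Local Open Scope fset_scope.

(** A disk is purely combinatorial here: a set of faces whose boundary edges are the sides of a
    3-cycle. One collapsing argument, which deletes faces together with edges while the graph stays
    connected, yields both the Jordan statement and the half of Euler's formula for disks that
    produces an inner vertex of degree 4. Minimality of [S] makes every 3-cycle with edges in [S] a
    face or the boundary of [S]; this is how a blocked contraction passes degree 4 on to a
    neighbour. A bipyramid needs a splitting first because the vertex opposite to a rim vertex is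
    again on the rim and joined to both apexes, which blocks every contraction; the splitting
    detaches two rim vertices from one apex. The reduction needs a seventh rim vertex, and the rim
    is even, so it stops at the hexagon. The octahedron stays excluded along the induction because
    no contraction ends in it. Splittings are treated as reversed contractions throughout, so that
    the equivalence has a single kind of generator. *)

Local Notation fc K a b c := ([fset a; b; c] \in K).

(** * Sets with three elements *)

Lemma neqF (T : eqType) (a b : T) :
  a != b -> ((a == b) = false) * ((b == a) = false).
Proof. by move=> /negbTE h; rewrite [b == a]eq_sym h. Qed.

Lemma fset3A (T : choiceType) (a b c : T) : [fset a; b; c] = [fset b; a; c].
Proof. by rewrite (fsetUC [fset a]). Qed.

Lemma fset3B (T : choiceType) (a b c : T) : [fset a; b; c] = [fset a; c; b].
Proof. by rewrite fsetUAC. Qed.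

Lemma card3 (T : choiceType) (a b c : T) :
  (#|` [fset a; b; c]| == 3) = uniq [:: a; b; c].
Proof.
rewrite -fsetUA cardfsU1 cardfs2 /= !inE !negb_or.
by case: (a == b); case: (a == c); case: (b == c).
Qed.

(** Distinctness is needed on one side only, since the cardinality forces it on the other. This
    reduces membership of a face in an explicit list of faces to equations between vertices. *)
Lemma eq3 (T : choiceType) (a b c d e f : T) : uniq [:: d; e; f] ->
  ([fset a; b; c] == [fset d; e; f]) =
  [|| [&& a == d, b == e & c == f], [&& a == d, b == f & c == e],
      [&& a == e, b == d & c == f], [&& a == e, b == f & c == d],
      [&& a == f, b == d & c == e] | [&& a == f, b == e & c == d]].
Proof.
move=> Udef; apply/eqP/idP; last first.
  move=> h; have {h}: [\/ [&& a == d, b == e & c == f], [&& a == d, b == f & c == e],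
      [&& a == e, b == d & c == f] | [|| [&& a == e, b == f & c == d],
      [&& a == f, b == d & c == e] | [&& a == f, b == e & c == d]]] by apply/or4P.
  case=> [||| /or3P[]]; case/and3P=> /eqP-> /eqP-> /eqP->; apply/fsetP=> t;
    by rewrite !inE; case: (t == d); case: (t == e); case: (t == f).
move=> E; have: uniq [:: a; b; c] by rewrite -card3 E card3.
have: a \in [fset d; e; f] by rewrite -E !inE eqxx.
have: b \in [fset d; e; f] by rewrite -E !inE eqxx orbT.
have: c \in [fset d; e; f] by rewrite -E !inE eqxx orbT.
rewrite /= !inE -!orbA => /or3P[] /eqP-> /or3P[] /eqP-> /or3P[] /eqP->;
  by rewrite ?eqxx ?orbT ?andbF //= ?orbT.
Qed.

Lemma eq3_at (T : choiceType) (a p q d e : T) : uniq [:: a; d; e] ->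
  ([fset a; p; q] == [fset a; d; e]) =
  ((p == d) && (q == e)) || ((p == e) && (q == d)).
Proof.
move=> U; rewrite eq3 // eqxx /=.
move: U; rewrite /= !inE negb_or andbT => /andP[/andP[h1 h2] _].
by rewrite !(neqF h1, neqF h2) /= ?orbF.
Qed.

Lemma card3P (T : choiceType) (f : {fset T}) :
  #|` f| = 3 -> exists a b c, f = [fset a; b; c] /\ uniq [:: a; b; c].
Proof.
move=> h; have: f != fset0 by rewrite -cardfs_gt0 h.
case/fset0Pn=> a af; move: (h); rewrite (cardfsD1 a) af add1n => -[h2].
have: f `\ a != fset0 by rewrite -cardfs_gt0 h2.
case/fset0Pn=> b bf; move: (h2); rewrite (cardfsD1 b) bf add1n => -[h1].
have: f `\ a `\ b != fset0 by rewrite -cardfs_gt0 h1.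
case/fset0Pn=> c cf; exists a, b, c.
have /eqP/cardfs1P[c' E] := h1.
have E2 : f = [fset a; b; c].
  move: cf; rewrite E inE => /eqP->.
  by rewrite -(fsetD1K af) -(fsetD1K bf) E fsetUA.
by split=> //; rewrite -card3 -E2 h.
Qed.

Lemma card3_at (T : choiceType) (f : {fset T}) (v : T) :
  #|` f| = 3 -> v \in f -> exists a b, f = [fset v; a; b] /\ uniq [:: v; a; b].
Proof.
move=> /card3P[a [b [c [-> U]]]]; rewrite !inE -orbA => /or3P[] /eqP->.
- by exists b, c.
- exists a, c; rewrite fset3A; split=> //.
  by move: U; rewrite -!card3 fset3A.
- exists a, b; rewrite fset3B (fset3A a c b); split=> //.
  by move: U; rewrite -!card3 fset3B (fset3A a c b).
Qed.

(** Predicates such as having degree 4 are existential propositions, so cutting out a set of faces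
    by them needs excluded middle in informative form. *)
Lemma fset_sep (T : choiceType) (K : {fset T}) (P : T -> Prop) :
  exists A : {fset T}, forall f, f \in A <-> f \in K /\ P f.
Proof.
exists [fset f in K | if excluded_middle_informative (P f) then true else false].
move=> f; rewrite !inE /=; case: excluded_middle_informative => h.
  by rewrite andbT; split=> // -[].
by rewrite andbF; split=> // -[].
Qed.

(** * Cyclic sequences *)

(** Oriented consecutive pairs along the path [a], [m], [b]. A cycle splits into two such arcs, and
    a move changes the link of a vertex in one arc only. *)
Definition arc_pairs (a : nat) (m : seq nat) (b : nat) : seq (nat * nat) :=
  zip (a :: m) (rcons m b).

Definition aedge a m b (p q : nat) := ((p, q) \in arc_pairs a m b) || ((q, p) \in arc_pairs a m b).

Definition pairs (c : seq nat) : seq (nat * nat) := zip c (rot 1 c).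

Definition cedge (c : seq nat) (p q : nat) := ((p, q) \in pairs c) || ((q, p) \in pairs c).

Lemma pairs_cons a s : pairs (a :: s) = arc_pairs a s a.
Proof. by rewrite /pairs rot1_cons. Qed.

Lemma arc_cons a x m b : arc_pairs a (x :: m) b = (a, x) :: arc_pairs x m b.
Proof. by []. Qed.

Lemma arc_cat a m b s d : arc_pairs a (m ++ b :: s) d = arc_pairs a m b ++ arc_pairs b s d.
Proof.
rewrite /arc_pairs rcons_cat rcons_cons -[m ++ b :: rcons s d]cat_rcons.
by rewrite -[a :: m ++ _]/((a :: m) ++ b :: s) zip_cat // size_rcons.
Qed.

Lemma mem_arc a m b p q : (p, q) \in arc_pairs a m b -> (p \in a :: m) && (q \in rcons m b).
Proof.
rewrite /arc_pairs => h; have S : size (a :: m) = size (rcons m b) by rewrite size_rcons.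
have := map_f fst h; have := map_f snd h.
by rewrite -/(unzip1 _) -/(unzip2 _) unzip1_zip ?unzip2_zip ?S //= => -> ->.
Qed.

Lemma pairs_rot n c : pairs (rot n c) = rot n (pairs c).
Proof.
rewrite /pairs -[rot n (zip _ _)]zip_unzip rot_rot /unzip1 /unzip2 !map_rot.
by rewrite -/(unzip1 _) -/(unzip2 _) unzip1_zip ?unzip2_zip ?size_rot.
Qed.

Lemma cedge_rot n c : cedge (rot n c) =2 cedge c.
Proof. by move=> p q; rewrite /cedge pairs_rot !mem_rot. Qed.

Lemma mem_zipC (s t : seq nat) p q : ((p, q) \in zip s t) = ((q, p) \in zip t s).
Proof.
elim: s t => [|x s IH] [|y t] //=; rewrite !inE !xpair_eqE IH.
by rewrite andbC.
Qed.

Lemma pairs_rev c p q : ((p, q) \in pairs (rev c)) = ((q, p) \in pairs c).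
Proof.
have E : pairs (rev c) = rev (zip c (rotr 1 c)).
  rewrite /pairs rev_zip ?size_rotr //; congr zip.
  by rewrite -rev_rotr.
rewrite E mem_rev mem_zipC.
have -> : zip (rotr 1 c) c = pairs (rotr 1 c) by rewrite /pairs rotrK.
by rewrite /rotr pairs_rot mem_rot.
Qed.

Lemma cedge_rev c : cedge (rev c) =2 cedge c.
Proof. by move=> p q; rewrite /cedge !pairs_rev orbC. Qed.

Lemma arc_head a m b q : uniq (a :: m) -> a != b ->
  ((a, q) \in arc_pairs a m b) = (q == head b m).
Proof.
move=> /= /andP[am _] ab; case: m am => [|x m] am; rewrite /arc_pairs /= !inE xpair_eqE eqxx /=.
  by [].
case E: ((a, q) \in _); last by rewrite orbF.
have := mem_arc E; by case/andP=> ham; rewrite ham in am.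
Qed.

Lemma arc_last a m b q : uniq (rcons m b) ->
  ((q, b) \in arc_pairs a m b) = (q == last a m).
Proof.
elim: m a => [|x m IH] a; first by rewrite /arc_pairs /= inE xpair_eqE eqxx andbT.
rewrite rcons_cons => /= /andP[xm U]; rewrite arc_cons inE xpair_eqE.
have -> : (b == x) = false.
  by apply/negbTE; apply: contra xm => /eqP->; rewrite mem_rcons mem_head.
by rewrite andbF /= IH.
Qed.

Lemma mem_pairs_next c x y : uniq c ->
  ((x, y) \in pairs c) = (x \in c) && (next c x == y).
Proof.
move=> U; case xc: (x \in c); last first.
  apply/negbTE; apply: contraFN xc; case: c U => [|a s] U; first by [].
  by rewrite pairs_cons => /mem_arc/andP[].
have [i s E] := rot_to xc.
have <- : next (rot i c) x = next c x by rewrite next_rot.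
rewrite -(mem_rot i) -pairs_rot E.
have Us : uniq (x :: s) by rewrite -E rot_uniq.
rewrite pairs_cons; case: s Us {E} => [|z s] Us.
  by rewrite /arc_pairs /= inE xpair_eqE eqxx /= eq_sym.
rewrite arc_cons inE xpair_eqE eqxx /= ?eqxx eq_sym.
case: (z == y) => //=; apply/negbTE; apply: contraL Us => /mem_arc/andP[h _].
by rewrite /= h.
Qed.

(** * Links of vertices *)

(** The link condition read off pairs of vertices instead of faces; it names the cycle, so that
    rotations, reversals and replacements of arcs can be computed. *)
Definition lk (K : complex) (v : nat) (c : seq nat) :=
  [/\ uniq c, 3 <= size c & forall p q, fc K v p q = cedge c p q].

Lemma lk_rot K v c n : lk K v c -> lk K v (rot n c).
Proof.
case=> U s h; split; rewrite ?rot_uniq ?size_rot // => p q.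
by rewrite cedge_rot h.
Qed.

Lemma lk_rev K v c : lk K v c -> lk K v (rev c).
Proof.
case=> U s h; split; rewrite ?rev_uniq ?size_rev // => p q.
by rewrite cedge_rev h.
Qed.

Lemma cedge_cons x y s p : uniq (x :: y :: s) ->
  cedge (x :: y :: s) x p = (p == y) || (p == last y s).
Proof.
move=> U; rewrite /cedge pairs_cons.
rewrite arc_cons !inE !xpair_eqE eqxx /=.
have xy : (x == y) = false by move: U; rewrite /= inE => /andP[/norP[/negbTE->]].
rewrite xy andbF /=; rewrite arc_last; last first.
  by rewrite rcons_uniq; move: U; rewrite /= inE => /and3P[/norP[_ ->] _ ->].
case E: ((x, p) \in _); last by rewrite orbF.
by move: (mem_arc E) U => /andP[/= h _] /andP[]; rewrite h.
Qed.

Lemma lk_next K v x y s p : lk K v (x :: y :: s) ->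
  fc K v x p = (p == y) || (p == last y s).
Proof. by case=> U _ ->; rewrite cedge_cons. Qed.

Lemma lk_norm K v c x y : lk K v c -> fc K v x y -> exists s, lk K v (x :: y :: s).
Proof.
move=> H; have [U sz h] := H; rewrite h /cedge.
wlog E : c H U sz h / (x, y) \in pairs c => [wl|_].
  case/orP=> E; first by apply: (wl c) => //; rewrite E.
  apply: (wl (rev c)); rewrite ?size_rev ?rev_uniq ?pairs_rev ?E //; first exact: lk_rev.
  by move=> p q; rewrite cedge_rev.
move: E; rewrite mem_pairs_next // => /andP[xc /eqP nx].
have [i s E] := rot_to xc; move: (lk_rot i H) (nx); rewrite E -(next_rot i) // E.
case: s E => [|z s] E.
  by have := size_rot i c; rewrite E /= => e; rewrite -e in sz.
by rewrite /= eqxx => H2 <-; exists s.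
Qed.

Lemma lk_norm3 K v c x y z : lk K v c -> fc K v x y -> fc K v y z -> x != z ->
  exists s, lk K v (x :: y :: z :: s).
Proof.
move=> H h1; have [s H2] := lk_norm H h1 => h2 xz.
have [U sz h] := H2; case: s U sz h H2 => [|t s] U sz h H2 //.
have := lk_rot 1 H2; rewrite rot1_cons /= => H3.
have := lk_next z H3; rewrite h2 last_rcons.
by case/esym/orP=> /eqP e; [exists s; rewrite e | rewrite e eqxx in xz].
Qed.

Lemma lk_norm4 K v c x y z t : lk K v c -> fc K v x y -> fc K v y z -> fc K v z t ->
  x != z -> y != t -> x != t -> exists s, lk K v (x :: y :: z :: t :: s).
Proof.
move=> H h1 h2 h3 xz yt xt; have [s H2] := lk_norm3 H h1 h2 xz.
have := lk_rot 1 H2; rewrite rot1_cons /= => H3.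
have := lk_rot 1 H3; rewrite rot1_cons /= => H4.
case: s H2 H3 H4 => [|r s] H2 H3 H4 /=.
  by have := lk_next t H4; rewrite /= h3 !(neqF xt, neqF yt).
have := lk_next t H4; rewrite h3 !last_rcons (neqF yt) orbF.
by move/esym/eqP=> ->; exists s.
Qed.

(** The face [v t x] makes [t] a neighbour of [x] other than [y], hence the last entry of the cycle,
    so nothing can follow it. *)
Lemma lk_closed4 K v c x y z t : lk K v c -> fc K v x y -> fc K v y z -> fc K v z t ->
  fc K v t x -> x != z -> y != t -> x != t -> lk K v [:: x; y; z; t].
Proof.
move=> H h1 h2 h3 h4 xz yt xt; have [s H2] := lk_norm4 H h1 h2 h3 xz yt xt.
have := lk_next t H2; rewrite fset3B h4 (neqF yt) /=.
case: s H2 => [|r s] H2 //= /esym/eqP e.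
have tr : t \in r :: s by rewrite e mem_last.
by case: H2; rewrite cons_uniq => /andP[_] /= /and3P[_ _ /andP[]]; rewrite tr.
Qed.

Lemma lk_mem K v c t : lk K v c -> t \in c -> exists r, fc K v t r.
Proof.
case=> U _ h tc; exists (next c t); rewrite h /cedge !mem_pairs_next //.
by rewrite tc eqxx.
Qed.

(* The second hypothesis makes the pairs of an arc and of its complementary
   arc distinct: both cycles have at least three elements. *)
Lemma lk_arc K L v a m m' b s : lk K v (a :: m ++ b :: s) ->
  (s != [::]) || ((m != [::]) && (m' != [::])) ->
  uniq (a :: m' ++ b :: s) ->
  (forall p q, fc L v p q = (fc K v p q && ~~ aedge a m b p q) || aedge a m' b p q) ->
  lk L v (a :: m' ++ b :: s).
Proof.
case=> U sz h sn U' hL; split=> //.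
  case: s sn {U sz h U'} => [|t s] /=; last by rewrite size_cat /= !addnS.
  by case: m' {hL} => [|? ?]; rewrite ?andbF //= size_cat /= addn1.
move=> p q; rewrite hL h /cedge !pairs_cons !arc_cat !mem_cat.
have aux p1 q1 : (p1, q1) \in arc_pairs b s a -> aedge a m b p1 q1 = false.
  move=> hb; apply/negbTE/negP=> ha; have /andP[pb qa] := mem_arc hb.
  move: U; rewrite -cat_cons cat_uniq => /and3P[U1 /hasPn dis U2].
  (* With equal orientations [p1] would lie in both halves of the cycle. Opposite orientations force
     [p1 = b] and [q1 = a], and then both arcs would be the single edge [ab]. *)
  case/orP: ha => ha; have /andP[h1 h2] := mem_arc ha.
    by have := dis _ pb; rewrite h1.
  have /eqP pE : p1 == b.
    move: h2; rewrite mem_rcons inE => /orP[//|pm].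
    by have := dis _ pb; rewrite inE pm orbT.
  have /eqP qE : q1 == a.
    move: qa; rewrite mem_rcons inE => /orP[//|qs].
    by have := dis q1; rewrite inE qs orbT h1 => /(_ isT).
  have ab : a != b.
    apply/eqP=> e; have := dis b (mem_head _ _); by rewrite e mem_head.
  move: hb ha; rewrite pE qE !arc_head ?(eq_sym b a) //.
  case: s sn dis {sz h U' hL U2 pb qa} => [|t s] sn dis /= => [_|/eqP e _].
    case: m sn U1 dis {h1 h2} => //= r m _ _ dis /eqP e.
    by have := dis b; rewrite !inE eqxx e eqxx orbT => /(_ isT).
  by have := dis t; rewrite !inE eqxx orbT -e eqxx => /(_ isT).
have auxC p1 q1 : aedge a m b p1 q1 = aedge a m b q1 p1 by rewrite /aedge orbC.
case E1: ((p, q) \in arc_pairs b s a).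
  by rewrite (aux _ _ E1) !orbT.
case E2: ((q, p) \in arc_pairs b s a).
  by rewrite auxC (aux _ _ E2) !orbT.
by rewrite !orbF /aedge; case: ((p, q) \in arc_pairs a m b); case: ((q, p) \in arc_pairs a m b).
Qed.

Ltac fcp := match goal with H : is_true (fc ?K _ _ _) |- is_true (fc ?K _ _ _) =>
  first [ exact H | rewrite fset3A; exact H | rewrite fset3B; exact H
        | rewrite fset3A fset3B; exact H | rewrite fset3B fset3A; exact H
        | rewrite fset3A fset3B fset3A; exact H ] end.

(** * Vertices, edges and links in terms of faces *)

Definition pure (K : complex) := forall f, f \in K -> #|` f| = 3.

Lemma fc_uniq K a b c : pure K -> fc K a b c -> uniq [:: a; b; c].
Proof. by move=> h /h/eqP; rewrite card3. Qed.

Lemma fc_neq K a b c : pure K -> fc K a b c -> [/\ a != b, a != c & b != c].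
Proof.
by move=> h /(fc_uniq h); rewrite /= !inE negb_or andbT => /andP[/andP[]].
Qed.

Lemma verticesP (K : complex) v :
  pure K -> v \in vertices K <-> exists a b, fc K v a b.
Proof.
move=> h; split.
  case/bigfcupP=> f /andP[fK _] vf.
  by have [a [b [E _]]] := card3_at (h _ fK) vf; exists a, b; rewrite -E.
case=> a [b vK]; apply/bigfcupP; exists [fset v; a; b]; rewrite ?vK //.
by rewrite !inE eqxx.
Qed.

Lemma edgesP (K : complex) e : pure K ->
  e \in edges K <-> exists a b c, e = [fset a; b] /\ fc K a b c.
Proof.
move=> h; split.
  case/bigfcupP=> f /andP[fK _]; rewrite !inE /= fpowersetE => /andP[ef /eqP e2].
  have [a [b [c [E U]]]] := card3P (h _ fK).
  have /eqP := cardfsDS ef; rewrite (h _ fK) e2 => /cardfs1P[r rE].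
  have rf : r \in f by have := fsubsetDl f e; rewrite rE fsub1set.
  have [p [q [E' _]]] := card3_at (h _ fK) rf; exists p, q, r.
  have eE : e = f `\ r by rewrite -rE fsetDK.
  have := h _ fK; rewrite E' => /eqP; rewrite card3 => U'.
  split; last by rewrite fset3B (fset3A p r q) -E'.
  rewrite eE E'; apply/fsetP=> t; rewrite !inE.
  move: U'; rewrite /= !inE negb_or => /andP[/andP[h1 h2] _].
  case: (altP (t =P r)) => [->|] //=; by rewrite !(neqF h1, neqF h2).
case=> a [b [c [-> abc]]]; apply/bigfcupP; exists [fset a; b; c]; rewrite ?abc //.
have [ab _ _] := fc_neq h abc.
rewrite !inE /= fpowersetE cardfs2 ab andbT.
by apply/fsubsetP=> t; rewrite !inE => ->.
Qed.

Lemma adjP (K : complex) x y : pure K -> adj K x y <-> exists z, fc K x y z.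
Proof.
move=> h; rewrite /adj edgesP //; split=> [[a [b [c [E abc]]]]|[z xyz]]; last by exists x, y, z.
by exists c; rewrite E.
Qed.

Lemma lkP (K : complex) v : pure K -> link_is_cycle K v <-> exists c, lk K v c.
Proof.
move=> h; split=> -[c].
  case=> U sz H; exists c; split=> // p q.
  apply/idP/idP=> [vK|].
    have /H[] : [fset v; p; q] \in K /\ v \in [fset v; p; q] by rewrite vK !inE eqxx.
    move=> x xc E; have /eqP := E; rewrite eq3_at; last by rewrite -card3 -E h.
    by rewrite /cedge !mem_pairs_next //; case/orP=> /andP[/eqP-> /eqP->];
      rewrite xc eqxx ?orbT.
  rewrite /cedge !mem_pairs_next //; case/orP=> /andP[xc /eqP<-].
    by have [] := (H [fset v; p; next c p]).2 (ex_intro2 _ _ p xc erefl).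
  by rewrite fset3B; have [] := (H [fset v; q; next c q]).2 (ex_intro2 _ _ q xc erefl).
case=> U sz H; exists c; split=> // f; split.
  case=> fK vf; have [a [b [E _]]] := card3_at (h _ fK) vf.
  move: fK; rewrite E H /cedge !mem_pairs_next //.
  case/orP=> /andP[ac /eqP<-]; [exists a|exists b] => //.
  by rewrite fset3B.
case=> x xc ->; rewrite H /cedge !mem_pairs_next // xc !eqxx /=; split=> //.
by rewrite !inE eqxx.
Qed.

Lemma tri_pure K : triangulation K -> pure K. Proof. by case. Qed.

Lemma tri_lk K v a b : triangulation K -> fc K v a b -> exists c, lk K v c.
Proof.
case=> _ h l _ vK; apply/lkP => //; apply: l; apply/verticesP => //.
by exists a, b.
Qed.

Lemma tri_norm K v x y : triangulation K -> fc K v x y ->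
  exists s, lk K v (x :: y :: s).
Proof. by move=> tK h; have [c lc] := tri_lk tK h; apply: lk_norm lc h. Qed.

Lemma tri_norm3 K v x y z : triangulation K -> fc K v x y -> fc K v y z ->
  x != z -> exists s, lk K v (x :: y :: z :: s).
Proof. by move=> tK h; have [c lc] := tri_lk tK h; apply: lk_norm3 lc h. Qed.

Lemma tri_norm4 K v x y z t : triangulation K ->
  fc K v x y -> fc K v y z -> fc K v z t ->
  x != z -> y != t -> x != t -> exists s, lk K v (x :: y :: z :: t :: s).
Proof. by move=> tK h; have [c lc] := tri_lk tK h; apply: lk_norm4 lc h. Qed.

Lemma tri_closed4 K v x y z t : triangulation K ->
  fc K v x y -> fc K v y z -> fc K v z t -> fc K v t x ->
  x != z -> y != t -> lk K v [:: x; y; z; t].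
Proof.
move=> tK h1 h2 h3 h4 xz yt; have [c lc] := tri_lk tK h1.
have [_ _ tx] := fc_neq (tri_pure tK) h4.
by apply: lk_closed4 lc h1 h2 h3 h4 xz yt _; rewrite eq_sym.
Qed.

Lemma triI K : K != fset0 -> pure K ->
  (forall v a b, fc K v a b -> exists c, lk K v c) -> connected K -> triangulation K.
Proof.
move=> h0 h l c; split=> // v /(verticesP _ h)[a [b /l]].
by rewrite lkP.
Qed.

(** * The moves preserve triangulations *)

Ltac uniqF U := let H := fresh in
  have H := U; rewrite /= ?inE ?negb_or ?andbT -?andbA in H;
  repeat match goal with H : is_true (_ && _) |- _ =>
    let h1 := fresh "N" in let h2 := fresh "N" in case/andP: H => h1 h2 end.

Ltac simpneq := rewrite ?eqxx; repeat match goal with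
  | H : is_true (?a != ?b) |- context [?a == ?b] => rewrite (negbTE H)
  | H : is_true (?a != ?b) |- context [?b == ?a] => rewrite (eq_sym b a) (negbTE H)
  end.

(** Evaluates membership in a complex after a move: comparisons with the listed faces are expanded
    by [eq3] and settled by the known inequalities of vertices. *)
Ltac fcE := rewrite ?inE ?eq3; [ | by rewrite /= ?inE; simpneq ..];
  rewrite ?eqxx; simpneq; rewrite /= ?andbF ?orbF /= ?andbT ?orbF.

Ltac boolcases := repeat match goal with
  |- context [?a == ?b] => case: (a == b);
    rewrite /= ?(andbF, andbT, orbT, orbF) /= ?(andbF, andbT, orbT, orbF) //= end.

Definition contract (K : complex) (u v w x y z : nat) : complex :=
  (K `\` [fset [fset u; w; x]; [fset u; x; y]; [fset u; y; z];
               [fset u; z; w]; [fset v; w; z]])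
  `|` [fset [fset v; w; x]; [fset v; x; y]; [fset v; y; z]].

Definition split_at (K : complex) (u v w x y z : nat) : complex :=
  (K `\` [fset [fset v; w; x]; [fset v; x; y]; [fset v; y; z]])
  `|` [fset [fset v; w; z]; [fset u; w; z]; [fset u; w; x];
            [fset u; x; y]; [fset u; y; z]].

(** The degree of [u] need not be prescribed: four faces that close up around [u] already exhaust
    its link. *)
Definition contractible K u v w x y z :=
  [/\ uniq [:: u; v; w; x; y; z],
      [/\ fc K u w x, fc K u x y, fc K u y z & fc K u z w],
      fc K v w z, ~~ adj K v x & ~~ adj K v y].

Definition splittable K u v w x y z :=
  [/\ uniq [:: u; v; w; x; y; z],
      [/\ fc K v w x, fc K v x y & fc K v y z],
      ~~ adj K w z & u \notin vertices K].

Section Contraction.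
Variables (K : complex) (u v w x y z : nat).
Hypotheses (tK : triangulation K) (cK : contractible K u v w x y z).
Let L := contract K u v w x y z.

Lemma contract_faces_at_u p q : fc K u p q = cedge [:: w; x; y; z] p q.
Proof.
have hK := tri_pure tK; case: cK => U [h1 h2 h3 h4] h5 _ _; uniqF U.
have [c lc] := tri_lk tK h1.
by have [_ _ ->] := lk_closed4 lc h1 h2 h3 h4 ltac:(done) ltac:(done) ltac:(done).
Qed.

(** Each link changes in one arc: at [w] and [z] a detour through [u] is cut short, at [x] and [y]
    the vertex [u] becomes [v], and at [v] the edge [wz] becomes the path [w x y z]. That [v] is
    adjacent to neither [x] nor [y] keeps the new cycles free of repetitions and long enough. *)
Lemma contract_lk s p q : fc L s p q -> exists c, lk L s c.
Proof.
have hK := tri_pure tK; case: cK => U [h1 h2 h3 h4] h5 nx ny.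
uniqF U.
have nvx t : fc K v x t = false.
  by apply/negbTE; apply: contraNN nx => h; apply/adjP => //; exists t.
have nvy t : fc K v y t = false.
  by apply/negbTE; apply: contraNN ny => h; apply/adjP => //; exists t.
have nmem r c t : lk K r c -> (forall h, fc K r t h = false) -> t \notin c.
  move=> lc hn; apply/negP=> /(lk_mem lc)[h]; by rewrite hn.
have nxv t : fc K x v t = false by rewrite fset3A.
have nyv t : fc K y v t = false by rewrite fset3A.
case: (altP (s =P u)) => [->|su].
  rewrite /L /contract; fcE; rewrite contract_faces_at_u /cedge /pairs /= !inE !xpair_eqE.
  by boolcases.
case: (altP (s =P w)) => [-> _|sw].
  have [r lr] : exists r, lk K w (v :: [:: z; u] ++ x :: r).
    by apply: tri_norm4 => //; try fcp; rewrite eq_sym.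
  exists (v :: [::] ++ x :: r); apply: (lk_arc lr).
  (* If [r] were empty, the cycle would close with the edge [xv], making [v] and [x] adjacent. *)
  - case: r lr => // -[_ _ /(_ x v)]; rewrite fset3A fset3B nxv.
    by rewrite /cedge /pairs /= !inE eqxx !orbT.
  - by case: lr => U' _ _; uniqF U'; rewrite /= !inE !negb_or;
    do ![apply/andP; split => //].
  - move=> p' q'; rewrite /L /contract; fcE.
    by rewrite /aedge /arc_pairs /= !inE !xpair_eqE; boolcases.
case: (altP (s =P z)) => [-> _|sz].
  have [r lr] : exists r, lk K z (v :: [:: w; u] ++ y :: r).
    by apply: tri_norm4 => //; try fcp; rewrite eq_sym.
  exists (v :: [::] ++ y :: r); apply: (lk_arc lr).
  - case: r lr => // -[_ _ /(_ y v)]; rewrite fset3A fset3B nyv.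
    by rewrite /cedge /pairs /= !inE eqxx !orbT.
  - by case: lr => U' _ _; uniqF U'; rewrite /= !inE !negb_or;
    do ![apply/andP; split => //].
  - move=> p' q'; rewrite /L /contract; fcE.
    by rewrite /aedge /arc_pairs /= !inE !xpair_eqE; boolcases.
case: (altP (s =P x)) => [-> _|sx].
  have [r lr] : exists r, lk K x (w :: [:: u] ++ y :: r).
    by apply: tri_norm3 => //; try fcp; rewrite eq_sym.
  have vr := nmem _ _ _ lr nxv.
  exists (w :: [:: v] ++ y :: r); apply: (lk_arc lr).
  - by rewrite orbT.
  - move: vr; case: lr => U' _ _; uniqF U'; rewrite /= !inE !negb_or => /and4P[*].
    by do ![apply/andP; split => //]; rewrite eq_sym.
  - move=> p' q'; rewrite /L /contract; fcE.
    by rewrite /aedge /arc_pairs /= !inE !xpair_eqE; boolcases.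
case: (altP (s =P y)) => [-> _|sy].
  have [r lr] : exists r, lk K y (x :: [:: u] ++ z :: r).
    by apply: tri_norm3 => //; try fcp; rewrite eq_sym.
  have vr := nmem _ _ _ lr nyv.
  exists (x :: [:: v] ++ z :: r); apply: (lk_arc lr).
  - by rewrite orbT.
  - move: vr; case: lr => U' _ _; uniqF U'; rewrite /= !inE !negb_or => /and4P[*].
    by do ![apply/andP; split => //]; rewrite eq_sym.
  - move=> p' q'; rewrite /L /contract; fcE.
    by rewrite /aedge /arc_pairs /= !inE !xpair_eqE; boolcases.
case: (altP (s =P v)) => [-> _|sv].
  have [r lr] : exists r, lk K v (w :: [::] ++ z :: r) by apply: tri_norm.
  have xr := nmem _ _ _ lr nvx; have yr := nmem _ _ _ lr nvy.
  exists (w :: [:: x; y] ++ z :: r); apply: (lk_arc lr).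
  - by case: r lr {xr yr} => // -[].
  - move: xr yr; case: lr => U' _ _; uniqF U'; rewrite /= !inE !negb_or => /and3P[? ? ?] /and3P[*].
    by do ![apply/andP; split => //]; rewrite eq_sym.
  - move=> p' q'; rewrite /L /contract; fcE.
    by rewrite /aedge /arc_pairs /= !inE !xpair_eqE; boolcases.
have E p' q' : fc L s p' q' = fc K s p' q' by rewrite /L /contract; fcE.
rewrite E => /(tri_lk tK)[c [Uc sc hc]]; exists c; split=> // p' q'.
by rewrite E.
Qed.
End Contraction.

(** * Connectedness and counts after a contraction *)

Definition reach (K : complex) x y := exists2 p, path (adj K) x p & last x p = y.

Lemma reach_refl K x : reach K x x. Proof. by exists [::]. Qed.

Lemma reach_adj K x y : adj K x y -> reach K x y.
Proof. by move=> h; exists [:: y]; rewrite //= h. Qed.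

Lemma reach_trans K y x z : reach K x y -> reach K y z -> reach K x z.
Proof.
by case=> p hp <- [q hq <-]; exists (p ++ q); rewrite ?cat_path ?hp // last_cat.
Qed.

Lemma adjC K x y : adj K x y = adj K y x.
Proof. by rewrite /adj fsetUC. Qed.

Lemma fc_adj K a b c : pure K -> fc K a b c -> adj K a b.
Proof. by move=> h abc; apply/adjP => //; exists c. Qed.

Lemma reach_sym K x y : reach K x y -> reach K y x.
Proof.
case=> p + <-; elim: p x => [|t p IH] x /=; first by move=> _; apply: reach_refl.
case/andP=> h /IH h2; apply: reach_trans h2 _; apply: reach_adj.
by rewrite adjC.
Qed.

Lemma face_adj (K : complex) (p q : nat) (f : {fset nat}) :
  f \in K -> p \in f -> q \in f -> p != q -> adj K p q.
Proof.
move=> fK pf qf pq; apply/bigfcupP; exists f; rewrite ?fK // !inE /= fpowersetE.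
by rewrite cardfs2 pq fsubUset !fsub1set pf qf.
Qed.

(** The moves delete edges and vertices, so an edge is only required to go to a connected pair, and
    a vertex of [L] only to be reachable from an image. *)
Lemma connected_map (K L : complex) (phi : nat -> nat) :
  connected K ->
  (forall x, x \in vertices L -> exists2 x', x' \in vertices K & reach L (phi x') x) ->
  (forall x y, adj K x y -> reach L (phi x) (phi y)) -> connected L.
Proof.
move=> cK sur h x y /sur[x' x'K xx'] /sur[y' y'K]; apply: reach_trans.
apply: reach_trans (reach_sym xx') _.
have [p] := cK _ _ x'K y'K; elim: p x' {x'K xx'} => [|t p IH] x' /=.
  by move=> _ ->; apply: reach_refl.
case/andP=> /h h1 /IH h2 /h2; exact: reach_trans.
Qed.

Lemma cardfsU1r (T : choiceType) (A : {fset T}) a :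
  #|` A `|` [fset a]| = ((a \notin A) + #|` A|)%N.
Proof. by rewrite fsetUC cardfsU1. Qed.

Section Contraction.
Variables (K : complex) (u v w x y z : nat).
Hypotheses (tK : triangulation K) (cK : contractible K u v w x y z).
Let L := contract K u v w x y z.

Lemma contract_pure : pure L.
Proof.
have hK := tri_pure tK; case: cK => U _ _ _ _; uniqF U.
move=> f; rewrite !inE => /orP[/andP[_ /hK] //|].
by case/orP=> [/orP[]|] /eqP->; apply/eqP; rewrite card3 /= !inE; simpneq.
Qed.

Lemma contract_no_u p q : fc L u p q = false.
Proof.
have hK := tri_pure tK; case: (cK) => U _ _ _ _; uniqF U.
rewrite /L /contract; fcE; rewrite (contract_faces_at_u tK cK) /cedge /pairs /=.
by rewrite !inE !xpair_eqE; boolcases.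
Qed.

Lemma contract_vertices : vertices L = vertices K `\ u.
Proof.
have hK := tri_pure tK; have hL := contract_pure.
case: (cK) => U [h1 h2 h3 h4] h5 _ _; uniqF U.
apply/fsetP=> t; apply/idP/idP.
  case/(verticesP _ hL)=> p [q tpq]; rewrite !inE.
  have tu : t != u by apply: contraTneq tpq => ->; rewrite contract_no_u.
  rewrite tu /=; apply/(verticesP _ hK); move: tpq.
  rewrite /L /contract; rewrite in_fsetU in_fsetD.
  case/orP=> [/andP[_ h]|]; first by exists p, q.
  have [hw hx hy hz hv] : [/\ exists p q, fc K w p q, exists p q, fc K x p q,
      exists p q, fc K y p q, exists p q, fc K z p q & exists p q, fc K v p q].
    split; [exists u, x|exists u, y|exists u, z|exists u, w|exists w, z]; fcp.
  rewrite !inE => /orP[/orP[]|] /eqP E;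
    by (have: t \in [fset t; p; q] by rewrite !inE eqxx);
       rewrite E !inE => /orP[/orP[]|] /eqP->.
rewrite !inE => /andP[tu /(verticesP _ hK)[p [q tpq]]]; apply/(verticesP _ hL).
have f1 : fc L v w x by rewrite /L /contract; fcE; rewrite ?eqxx ?orbT.
have f2 : fc L v x y by rewrite /L /contract; fcE; rewrite ?eqxx ?orbT.
have f3 : fc L v y z by rewrite /L /contract; fcE; rewrite ?eqxx ?orbT.
case: (boolP (t \in [:: v; w; x; y; z])) => [|tn].
  rewrite !inE => /or4P[/eqP->|/eqP->|/eqP->|/orP[]/eqP->].
  - by exists w, x.
  - by exists v, x; fcp.
  - by exists v, w; fcp.
  - by exists v, x; fcp.
  - by exists v, y; fcp.
exists p, q; uniqF tn; rewrite /L /contract; fcE; exact: tpq.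
Qed.

Lemma contract_connected : connected L.
Proof.
have hK := tri_pure tK; have hL := contract_pure.
case: (cK) => U [h1 h2 h3 h4] h5 _ _; uniqF U.
have f1 : fc L v w x by rewrite /L /contract; fcE; rewrite ?eqxx ?orbT.
have f2 : fc L v x y by rewrite /L /contract; fcE; rewrite ?eqxx ?orbT.
have f3 : fc L v y z by rewrite /L /contract; fcE; rewrite ?eqxx ?orbT.
(* The contraction seen as merging [u] into [v]; among the six vertices of the configuration
   everything is then connected through [v]. *)
pose phi s := if s == u then v else s.
have star s : s \in [:: u; v; w; x; y; z] -> phi s = v \/ adj L v (phi s).
  rewrite !inE /phi; case: eqP => [_ _|_ /=]; first by left.
  case/or4P=> [/eqP->|/eqP->|/eqP->|/orP[]/eqP->]; [by left|right..].
  - exact: fc_adj f1.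
  - exact: fc_adj f2.
  - exact: fc_adj f3.
  - by apply: fc_adj hL _; rewrite fset3B; exact: f3.
have star2 s t : s \in [:: u; v; w; x; y; z] -> t \in [:: u; v; w; x; y; z] ->
    reach L (phi s) (phi t).
  move=> /star hs /star ht; apply: (@reach_trans _ v).
    by case: hs => [->|?]; [apply: reach_refl|apply: reach_adj; rewrite adjC].
  by case: ht => [->|?]; [apply: reach_refl|apply: reach_adj].
apply: (@connected_map K L phi); first by case: tK.
  move=> s; rewrite contract_vertices !inE => /andP[su sK].
  by exists s => //; rewrite /phi (negbTE su); apply: reach_refl.
move=> s t /(adjP _ _ hK)[r str].
case: (boolP ((s \in [:: u; v; w; x; y; z]) && (t \in [:: u; v; w; x; y; z]))).
  by case/andP; apply: star2.
rewrite negb_and => n; apply: reach_adj.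
have strL : fc L s t r.
  by case/orP: n => n; uniqF n; rewrite /L /contract; fcE; exact: str.
have [su tu] : s != u /\ t != u.
  split; apply: contraTneq strL => ->; rewrite ?contract_no_u //.
  by rewrite fset3A contract_no_u.
by rewrite /phi (negbTE su) (negbTE tu); apply: fc_adj strL.
Qed.

Lemma contract_tri : triangulation L.
Proof.
apply: triI; [|exact: contract_pure|exact: contract_lk|exact: contract_connected].
by apply/fset0Pn; exists [fset v; w; x]; rewrite !inE eqxx ?orbT.
Qed.

(** The edge [wz] lay in exactly two faces, those with [u] and [v], and both are deleted. This is
    what makes the reverse move a splitting. *)
Lemma contract_new_faces :
  [/\ fc L v w x, fc L v x y & fc L v y z] /\ ~~ adj L w z.
Proof.
have hK := tri_pure tK; have hL := contract_pure.
case: (cK) => U [h1 h2 h3 h4] h5 _ _; uniqF U.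
split; first by split; rewrite /L /contract; fcE; rewrite ?eqxx ?orbT.
apply/negP=> /(adjP _ _ hL)[t].
have [r' lr'] : exists r, lk K w (u :: z :: v :: r).
  by apply: tri_norm3 => //; fcp.
have := lk_rot 1 lr'; rewrite rot1_cons /= => lr2.
have := lk_next t lr2; rewrite last_rcons /L /contract.
fcE => -> /andP[+ /orP[]/eqP E]; rewrite E; simpneq; by rewrite ?eqxx ?orbT ?andbF.
Qed.

Lemma contractK : split_at L u v w x y z = K.
Proof.
have hK := tri_pure tK; case: (cK) => U [h1 h2 h3 h4] h5 nx ny; uniqF U.
have nvx t : fc K v x t = false.
  by apply/negbTE; apply: contraNN nx => h; apply/adjP => //; exists t.
have nvy t : fc K v y t = false.
  by apply/negbTE; apply: contraNN ny => h; apply/adjP => //; exists t.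
have n1 : fc K v w x = false by rewrite fset3B.
apply/fsetP=> f; rewrite /split_at /L /contract !inE.
case: (altP (f =P [fset v; w; x])) => [->|_]; first by rewrite n1; fcE.
case: (altP (f =P [fset v; x; y])) => [->|_]; first by rewrite nvx; fcE.
case: (altP (f =P [fset v; y; z])) => [->|_]; first by rewrite nvy; fcE.
case: (altP (f =P [fset v; w; z])) => [->|_]; first by rewrite h5 ?orbT.
case: (altP (f =P [fset u; w; x])) => [->|_]; first by rewrite h1 ?orbT.
case: (altP (f =P [fset u; x; y])) => [->|_]; first by rewrite h2 ?orbT.
case: (altP (f =P [fset u; y; z])) => [->|_]; first by rewrite h3 ?orbT.
rewrite (fset3B u w z).
case: (altP (f =P [fset u; z; w])) => [->|_]; first by rewrite h4 ?orbT.
by rewrite /= ?orbF.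
Qed.

Lemma contract_card_faces : (#|` L| + 2 = #|` K|)%N.
Proof.
have hK := tri_pure tK; case: (cK) => U [h1 h2 h3 h4] h5 nx ny; uniqF U.
have nvx t : fc K v x t = false.
  by apply/negbTE; apply: contraNN nx => h; apply/adjP => //; exists t.
have nvy t : fc K v y t = false.
  by apply/negbTE; apply: contraNN ny => h; apply/adjP => //; exists t.
have n1 : fc K v w x = false by rewrite fset3B.
pose A := [fset [fset u; w; x]; [fset u; x; y]; [fset u; y; z];
               [fset u; z; w]; [fset v; w; z]].
pose B := [fset [fset v; w; x]; [fset v; x; y]; [fset v; y; z]].
have cA : #|` A| = 5 by rewrite /A 4!cardfsU1r cardfs1; fcE.
have cB : #|` B| = 3 by rewrite /B 2!cardfsU1r cardfs1; fcE.
have AK : A `<=` K.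
  by rewrite /A !fsubUset !fsub1set h1 h2 h3 h4 h5.
have dis : (K `\` A) `&` B = fset0.
  apply/fsetP=> f; rewrite in_fsetI in_fsetD in_fset0 /B !inE.
  case: (altP (f =P [fset v; w; x])) => [->|_]; first by rewrite n1 andbF.
  case: (altP (f =P [fset v; x; y])) => [->|_]; first by rewrite nvx andbF.
  case: (altP (f =P [fset v; y; z])) => [->|_]; first by rewrite nvy andbF.
  by rewrite andbF.
have := cardfsUI (K `\` A) B; rewrite dis cardfs0 addn0 cB cardfsDS // cA.
rewrite -/L; have := fsubset_leq_card AK; rewrite cA => c5 ->.
by rewrite -addnA subnK.
Qed.

Lemma contract_card_vertices : (#|` vertices L| + 1 = #|` vertices K|)%N.
Proof.
have hK := tri_pure tK; case: (cK) => U [h1 _ _ _] _ _ _.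
rewrite contract_vertices [RHS](cardfsD1 u) addnC.
by have /(verticesP _ hK)-> : exists p q, fc K u p q by exists w, x.
Qed.

(** [u] and [v] face the same edge [wz], so three colours force them to agree, and the new edges
    [vx] and [vy] are coloured like [ux] and [uy]. *)
Lemma contract_balanced : balanced K -> balanced L.
Proof.
have hK := tri_pure tK; have hL := contract_pure.
case: (cK) => U [h1 h2 h3 h4] h5 _ _ [c hc].
have nc a b d : fc K a b d -> c a != c b.
  by move=> h; apply/eqP; apply: hc; apply: fc_adj h.
have cuv : c u = c v.
  have hu : c u != c w by apply: nc h1.
  have hu' : c u != c z by apply: nc h4.
  have hv : c v != c w by apply: nc h5.
  have hv' : c v != c z by apply: (@nc _ _ w); rewrite fset3B.
  have hw : c w != c z by apply: (@nc _ _ u); fcp.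
  by apply: val_inj; move: hu hu' hv hv' hw; rewrite -!val_eqE /=;
    case: (c u) (c v) (c w) (c z) => [a ha] [b hb] [d hd] [e he] /=; lia.
exists c => s t /(adjP _ _ hL)[r].
rewrite /L /contract in_fsetU in_fsetD => /orP[/andP[_ /nc /eqP //]|].
have e1 : c v != c w by apply: nc h5.
have e2 : c v != c x by rewrite -cuv; apply: nc h2.
have e3 : c v != c y by rewrite -cuv; apply: nc h3.
have e4 : c v != c z by rewrite -cuv; apply: nc h4.
have e5 : c w != c x by apply: (@nc _ _ u); fcp.
have e6 : c x != c y by apply: (@nc _ _ u); fcp.
have e7 : c y != c z by apply: (@nc _ _ u); fcp.
uniqF U; rewrite !inE !eq3; [|by rewrite /= !inE; simpneq..] => h.
by case: (orP h) => {h} [/orP[]|] /or4P[||| /or3P[]] /and3P[/eqP-> /eqP-> _];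
  apply/eqP; rewrite // eq_sym.
Qed.
End Contraction.

(** * Splittings as inverses of contractions *)

Section Splitting.
Variables (K : complex) (u v w x y z : nat).
Hypotheses (tK : triangulation K) (sK : splittable K u v w x y z).
Let L := split_at K u v w x y z.

Lemma split_no_u p q : fc K u p q = false.
Proof.
case: sK => _ _ _ nu; apply/negbTE; apply: contra nu => h.
by apply/(verticesP _ (tri_pure tK)); exists p, q.
Qed.

Lemma split_pure : pure L.
Proof.
have hK := tri_pure tK; case: sK => U _ _ _; uniqF U.
move=> f; rewrite !inE => /orP[/andP[_ /hK] //|].
by case/orP=> [/orP[/orP[/orP[]|]|]|] /eqP->; apply/eqP; rewrite card3 /= !inE; simpneq.
Qed.

Lemma split_new_faces :
  [/\ fc L u w x, fc L u x y, fc L u y z & fc L u z w] /\ fc L v w z.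
Proof.
case: sK => U _ _ _; uniqF U.
by split; [split|]; rewrite /L /split_at; fcE; rewrite ?eqxx ?orbT.
Qed.

(** The replacements of arcs in [contract_lk], made in the other direction. Now the freshness of [u]
    and the missing edge [wz] prevent repetitions. *)
Lemma split_lk s p q : fc L s p q -> exists c, lk L s c.
Proof.
have hK := tri_pure tK; case: sK => U [h1 h2 h3] nwz _.
uniqF U.
have nu t t' := split_no_u t t'.
have nwz' t : fc K w z t = false.
  by apply/negbTE; apply: contraNN nwz => h; apply/adjP => //; exists t.
have nzw t : fc K z w t = false by rewrite fset3A.
have nmem r c t : lk K r c -> (forall h, fc K r t h = false) -> t \notin c.
  move=> lc hn; apply/negP=> /(lk_mem lc)[h]; by rewrite hn.
have nur r c : lk K r c -> u \notin c.
  by move=> lc; apply: (nmem _ _ _ lc) => h; rewrite fset3A.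
case: (altP (s =P u)) => [-> _|su].
  exists [:: w; x; y; z]; split=> //.
    by move: U => /= /and5P[_ _ -> -> ->].
  move=> p' q'; rewrite /L /split_at; fcE.
  by rewrite nu /cedge /pairs /= !inE !xpair_eqE; boolcases.
case: (altP (s =P w)) => [-> _|sw].
  have [r lr] : exists r, lk K w (v :: [::] ++ x :: r) by apply: tri_norm => //; fcp.
  exists (v :: [:: z; u] ++ x :: r); apply: (lk_arc lr).
  - by case: r lr => // -[].
  - move: (nmem _ _ _ lr nwz') (nur _ _ lr); case: lr => U' _ _; uniqF U'.
    rewrite /= !inE !negb_or => /and3P[? ? ?] /and3P[*].
    by do ![apply/andP; split => //]; rewrite eq_sym.
  - move=> p' q'; rewrite /L /split_at; fcE.
    by rewrite /aedge /arc_pairs /= !inE !xpair_eqE; boolcases.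
case: (altP (s =P z)) => [-> _|sz].
  have [r lr] : exists r, lk K z (v :: [::] ++ y :: r) by apply: tri_norm => //; fcp.
  exists (v :: [:: w; u] ++ y :: r); apply: (lk_arc lr).
  - by case: r lr => // -[].
  - move: (nmem _ _ _ lr nzw) (nur _ _ lr); case: lr => U' _ _; uniqF U'.
    rewrite /= !inE !negb_or => /and3P[? ? ?] /and3P[*].
    by do ![apply/andP; split => //]; rewrite eq_sym.
  - move=> p' q'; rewrite /L /split_at; fcE.
    by rewrite /aedge /arc_pairs /= !inE !xpair_eqE; boolcases.
case: (altP (s =P x)) => [-> _|sx].
  have [r lr] : exists r, lk K x (w :: [:: v] ++ y :: r).
    by apply: tri_norm3 => //; try fcp; rewrite eq_sym.
  exists (w :: [:: u] ++ y :: r); apply: (lk_arc lr).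
  - by rewrite orbT.
  - move: (nur _ _ lr); case: lr => U' _ _; uniqF U'; rewrite /= !inE !negb_or => /and4P[*].
    by do ![apply/andP; split => //]; rewrite eq_sym.
  - move=> p' q'; rewrite /L /split_at; fcE.
    by rewrite /aedge /arc_pairs /= !inE !xpair_eqE; boolcases.
case: (altP (s =P y)) => [-> _|sy].
  have [r lr] : exists r, lk K y (x :: [:: v] ++ z :: r).
    by apply: tri_norm3 => //; try fcp; rewrite eq_sym.
  exists (x :: [:: u] ++ z :: r); apply: (lk_arc lr).
  - by rewrite orbT.
  - move: (nur _ _ lr); case: lr => U' _ _; uniqF U'; rewrite /= !inE !negb_or => /and4P[*].
    by do ![apply/andP; split => //]; rewrite eq_sym.
  - move=> p' q'; rewrite /L /split_at; fcE.
    by rewrite /aedge /arc_pairs /= !inE !xpair_eqE; boolcases.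
case: (altP (s =P v)) => [-> _|sv].
  have [r lr] : exists r, lk K v (w :: [:: x; y] ++ z :: r) by apply: tri_norm4.
  exists (w :: [::] ++ z :: r); apply: (lk_arc lr).
  - case: r lr => // -[_ _ /(_ z w)]; rewrite fset3A fset3B nzw.
    by rewrite /cedge /pairs /= !inE eqxx !orbT.
  - by case: lr => U' _ _; uniqF U'; rewrite /= !inE !negb_or;
    do ![apply/andP; split => //].
  - move=> p' q'; rewrite /L /split_at; fcE.
    by rewrite /aedge /arc_pairs /= !inE !xpair_eqE; boolcases.
have E p' q' : fc L s p' q' = fc K s p' q' by rewrite /L /split_at; fcE.
rewrite E => /(tri_lk tK)[c [Uc sc hc]]; exists c; split=> // p' q'.
by rewrite E.
Qed.

Lemma split_connected : connected L.
Proof.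
have hK := tri_pure tK; have hL := split_pure.
case: (sK) => U [h1 h2 h3] _ _; uniqF U.
have [[f1 f2 f3 f4] f5] := split_new_faces.
have star s : s \in [:: v; w; x; y; z] -> reach L u s.
  rewrite !inE => /or4P[/eqP->|/eqP->|/eqP->|/orP[]/eqP->]; last 4 first.
  - by apply: reach_adj; apply: fc_adj f1.
  - by apply: reach_adj; apply: fc_adj f2.
  - by apply: reach_adj; apply: fc_adj f3.
  - by apply: reach_adj; apply: fc_adj f4.
  apply: (@reach_trans _ w); apply: reach_adj; first exact: fc_adj f1.
  by apply: (@fc_adj _ _ _ z) => //; fcp.
apply: (@connected_map K L id); first by case: tK.
  move=> s /(verticesP _ hL)[p [q spq]]; case: (altP (s =P u)) => [->|su].
    exists w; first by apply/(verticesP _ hK); exists v, x; fcp.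
    by apply/reach_sym/star; rewrite !inE eqxx orbT.
  exists s; last exact: reach_refl.
  apply/(verticesP _ hK); case: (boolP (s \in [:: v; w; x; y; z])) => [|n].
    rewrite !inE => /or4P[/eqP->|/eqP->|/eqP->|/orP[]/eqP->].
    - by exists w, x.
    - by exists v, x; fcp.
    - by exists v, w; fcp.
    - by exists v, x; fcp.
    - by exists v, y; fcp.
  by exists p, q; uniqF n; move: spq; rewrite /L /split_at; fcE.
move=> s t /(adjP _ _ hK)[r str].
case: (boolP ((s \in [:: v; w; x; y; z]) && (t \in [:: v; w; x; y; z]))).
  by case/andP=> /star hs /star; apply: reach_trans; apply: reach_sym.
have nu r1 r2 : fc K u r1 r2 = false := split_no_u r1 r2.
have su : s != u by apply: contraTneq str => ->; rewrite nu.
have tu : t != u by apply: contraTneq str => ->; rewrite fset3A nu.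
rewrite negb_and => n; apply: reach_adj; apply: (@fc_adj _ _ _ r) => //.
by case/orP: n => n; uniqF n; rewrite /L /split_at; fcE; exact: str.
Qed.

Lemma split_tri : triangulation L.
Proof.
apply: triI; [|exact: split_pure|exact: split_lk|exact: split_connected].
by apply/fset0Pn; exists [fset v; w; z]; rewrite !inE eqxx ?orbT.
Qed.

(** Each of [vx] and [vy] lay in exactly two faces, both among the three deleted ones, so these
    edges are gone. *)
Lemma split_contractible : contractible L u v w x y z.
Proof.
have hK := tri_pure tK; have hL := split_pure.
case: (sK) => U [h1 h2 h3] _ _; have [f1 f2] := split_new_faces.
uniqF U; split=> //; apply/negP=> /(adjP _ _ hL)[t].
  have [r' lr'] : exists r, lk K v (w :: x :: y :: r) by apply: tri_norm3.
  have := lk_rot 1 lr'; rewrite rot1_cons /= => lr2.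
  have := lk_next t lr2; rewrite last_rcons /L /split_at.
  by fcE => -> /andP[+ /orP[]/eqP E]; rewrite E; simpneq; rewrite ?eqxx ?orbT ?andbF.
have [r' lr'] : exists r, lk K v (x :: y :: z :: r) by apply: tri_norm3.
have := lk_rot 1 lr'; rewrite rot1_cons /= => lr2.
have := lk_next t lr2; rewrite last_rcons /L /split_at.
by fcE => -> /andP[+ /orP[]/eqP E]; rewrite E; simpneq; rewrite ?eqxx ?orbT ?andbF.
Qed.

Lemma splitK : contract L u v w x y z = K.
Proof.
have nu := split_no_u.
have hK := tri_pure tK; case: (sK) => U [h1 h2 h3] nwz _; uniqF U.
have n1 : fc K v w z = false.
  apply/negbTE; apply: contraNN nwz => h; apply/adjP => //; exists v; fcp.
apply/fsetP=> f; rewrite /split_at /L /contract !inE (fset3B u z w).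
case: (altP (f =P [fset v; w; x])) => [->|_]; first by rewrite h1 ?orbT.
case: (altP (f =P [fset v; x; y])) => [->|_]; first by rewrite h2 ?orbT.
case: (altP (f =P [fset v; y; z])) => [->|_]; first by rewrite h3 ?orbT.
case: (altP (f =P [fset v; w; z])) => [->|_]; first by rewrite n1 ?orbT ?andbF.
case: (altP (f =P [fset u; w; x])) => [->|_]; first by rewrite nu ?orbT ?andbF.
case: (altP (f =P [fset u; x; y])) => [->|_]; first by rewrite nu ?orbT ?andbF.
case: (altP (f =P [fset u; y; z])) => [->|_]; first by rewrite nu ?orbT ?andbF.
case: (altP (f =P [fset u; w; z])) => [->|_]; first by rewrite nu ?orbT ?andbF.
by rewrite /= ?orbF.
Qed.

Lemma split_balanced : balanced K -> balanced L.
Proof.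
have hK := tri_pure tK; have hL := split_pure.
case: (sK) => U [h1 h2 h3] _ _ [c hc].
have nu := split_no_u.
have nc a b d : fc K a b d -> c a != c b.
  by move=> h; apply/eqP; apply: hc; apply: fc_adj h.
have e1 : c v != c w by apply: nc h1.
have e2 : c v != c x by apply: nc h2.
have e3 : c v != c y by apply: nc h3.
have e4 : c v != c z by apply: (@nc _ _ y); fcp.
have e5 : c w != c x by apply: (@nc _ _ v); fcp.
have e6 : c x != c y by apply: (@nc _ _ v); fcp.
have e7 : c y != c z by apply: (@nc _ _ v); fcp.
(* [w], [x], [y], [z] alternate between the two colours different from that of [v], and [w] and [z]
   are three steps apart. *)
have e8 : c w != c z.
  move: e1 e2 e3 e4 e5 e6 e7; rewrite -!val_eqE /=.
  by case: (c v) (c w) (c x) (c y) (c z) => [a ha] [b hb] [d hd] [e he] [g hg] /=; lia.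
pose c' s := if s == u then c v else c s.
have c'u : c' u = c v by rewrite /c' eqxx.
have c'n s : s != u -> c' s = c s by rewrite /c' => /negbTE->.
uniqF U; exists c' => s t /(adjP _ _ hL)[r].
rewrite /L /split_at in_fsetU in_fsetD => /orP[/andP[_ h]|].
  have su : s != u by apply: contraTneq h => ->; rewrite nu.
  have tu : t != u by apply: contraTneq h => ->; rewrite fset3A nu.
  by rewrite !c'n //; apply/eqP; apply: nc h.
rewrite !inE !eq3; [|by rewrite /= !inE; simpneq..] => h.
by case: (orP h) => {h} [/orP[/orP[/orP[]|]|]|] /or4P[||| /or3P[]] /and3P[/eqP-> /eqP-> _];
  apply/eqP; rewrite ?c'u ?c'n // eq_sym.
Qed.
End Splitting.

(** * Boundaries of sets of faces *)

(** On a closed surface an edge lies in two faces, so this is the boundary of the chain [S] modulo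
    2. *)
Definition bd (K S : complex) x y := exists s t,
  [/\ fc K x y s, fc K x y t, fc S x y s & ~~ fc S x y t].

Lemma nbd K S x y s t : ~ bd K S x y ->
  fc K x y s -> fc K x y t -> fc S x y s -> fc S x y t.
Proof.
move=> n h1 h2 h3; case E: (fc S x y t) => //; case: n.
by exists s, t; rewrite E.
Qed.

Lemma bdC K S x y : bd K S x y -> bd K S y x.
Proof. by case=> s [t H]; exists s, t; rewrite !(fset3A y x). Qed.

Lemma bd_compl K S x y : bd K (K `\` S) x y -> bd K S x y.
Proof.
case=> s [t []]; rewrite !in_fsetD => h1 h2; rewrite h1 h2 !andbT => h3 /negPn h4.
by exists t, s.
Qed.

(** Connectedness of the graph after [R] is shrunk to a point, phrased through cuts: this form makes
    the deletion of a bypassed edge easy to check. *)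
Definition cut (V : {fset nat}) (E : {fset {fset nat}}) (R : {fset nat}) :=
  forall R', R `<=` R' -> (exists2 v, v \in V & v \notin R') ->
  exists s r, [/\ [fset s; r] \in E, s \in V, s \notin R' & r \in R'].

(** The count of edges in a spanning tree: [R] grows by one vertex at a time, and the edge that
    reaches this vertex is never counted again. *)
Lemma cut_count V E R : cut V E R ->
  #|` V `\` R| <= #|` [fset e in E | ~~ (e `<=` R)]|.
Proof.
have [n] := ubnP #|` V `\` R|; elim: n R => // n IH R leN cR.
case: (fset_0Vmem (V `\` R)) => [->|[v]]; first by rewrite cardfs0.
rewrite in_fsetD => /andP[vR vV].
have [|s [r [sr sV sR rR]]] := cR R (fsubset_refl _); first by exists v.
have sVR : s \in V `\` R by rewrite in_fsetD sR.
have E1 : V `\` (s |` R) = (V `\` R) `\ s by rewrite fsetUC fsetDDl.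
have c1 : #|` V `\` R| = (#|` (V `\` R) `\ s|).+1 by rewrite (cardfsD1 s) sVR.
have := IH (s |` R); rewrite E1 c1; move: leN; rewrite c1 ltnS => leN.
move=> /(_ leN) H; rewrite [X in _ <= X](cardfsD1 [fset s; r]).
have -> : [fset s; r] \in [fset e in E | ~~ (e `<=` R)].
  rewrite !inE /= sr; apply/fsubsetPn; exists s => //; exact: fset21.
rewrite add1n ltnS; apply: leq_trans (H _) _.
  move=> R' sub; apply: cR; apply: fsubset_trans sub; exact: fsubsetUr.
apply: fsubset_leq_card; apply/fsubsetP=> e; rewrite !inE /= => /andP[-> n1].
rewrite /=; apply/andP; split.
  apply: contra n1 => /eqP->; rewrite fsubUset !fsub1set !inE eqxx rR.
  by rewrite orbT.
apply: contra n1 => h; apply: fsubset_trans h _; exact: fsubsetUr.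
Qed.

Lemma eq2 (a b c d : nat) : ([fset a; b] == [fset c; d]) =
  ((a == c) && (b == d)) || ((a == d) && (b == c)).
Proof.
apply/eqP/idP=> [E|]; last first.
  by case/orP=> /andP[/eqP-> /eqP->] //; rewrite fsetUC.
have := fset21 a b; have := fset22 a b; rewrite E !in_fset2.
have := fset21 c d; have := fset22 c d; rewrite -E !in_fset2.
by do 4![case/orP=> /eqP ?]; subst; rewrite !eqxx ?orbT.
Qed.

Lemma cut_remove V E R x y s : cut V E R -> uniq [:: x; y; s] -> s \in V ->
  [fset x; s] \in E -> [fset y; s] \in E -> cut V (E `\ [fset x; y]) R.
Proof.
move=> cE U sV xs ys R' sub /(cE _ sub)[p [r [prE pV pR rR]]].
case: (boolP ([fset p; r] == [fset x; y])) => [|n]; last first.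
  by exists p, r; rewrite !inE n.
move: U; rewrite /= !inE negb_or andbT => /andP[/andP[xy xs'] ys'].
have nxs : [fset x; s] != [fset x; y] by rewrite eq2 !(neqF ys', neqF xy, neqF xs') andbF.
have nys : [fset y; s] != [fset x; y].
  by rewrite eq2 !(neqF ys', neqF xy, neqF xs') ?andbF.
have [sR|sR] := boolP (s \in R').
  rewrite eq2 => /orP[]/andP[/eqP pE /eqP rE]; exists p, s; rewrite !inE pE in pR pV *.
    by rewrite nxs xs.
  by rewrite nys ys.
rewrite eq2 => /orP[]/andP[/eqP pE /eqP rE]; exists s, r; rewrite !inE rE in rR *.
  by rewrite fsetUC nys ys.
by rewrite fsetUC nxs xs.
Qed.

(** * Discrete Jordan theorem and Euler inequality for disks *)

Section Topology.
Variable K : complex.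
Hypothesis tK : triangulation K.
Let hK := tri_pure tK.

Lemma edge_faces x y s : fc K x y s ->
  exists2 t, t != s & forall r, fc K x y r = (r == s) || (r == t).
Proof.
move=> /(tri_norm tK)[l lx]; exists (last s l); last by move=> r; apply: lk_next lx.
case: lx => U sz _; case: l U sz => // a l /= /and3P[_ + _] _.
by rewrite inE => n; apply: contraNneq n => <-; rewrite -[_ || _]/(_ \in a :: l) mem_last.
Qed.

Lemma bd_faces S x y : bd K S x y -> exists s t,
  [/\ fc S x y s, ~~ fc S x y t, fc K x y t, t != s
    & forall r, fc K x y r = (r == s) || (r == t)].
Proof.
case=> s [t [h1 h2 h3 h4]]; have [t' nt E] := edge_faces h1.
have ts : t != s by apply: contraNneq h4 => ->.
by move: h2 (h2); rewrite {1}E (negbTE ts) => /eqP e h2; exists s, t; split=> //; rewrite e.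
Qed.

(** In a walk along the link of [x], membership in [S] passes from one face to the next as long as
    the edge between them is not a boundary edge. *)
Lemma star_chain S x a m e : (forall p q, (p, q) \in arc_pairs a m e -> fc K x p q) ->
  (forall b, b \in m -> ~ bd K S x b) -> fc S x a (head e m) ->
  forall p q, (p, q) \in arc_pairs a m e -> fc S x p q.
Proof.
elim: m a => [|b m IH] a hm nb h p q.
  by rewrite /arc_pairs inE xpair_eqE => /andP[/eqP-> /eqP->].
rewrite arc_cons inE xpair_eqE => /orP[/andP[/eqP-> /eqP->] //|].
apply: IH => [p' q' h'|b' h'|].
- by apply: hm; rewrite arc_cons inE h' orbT.
- by apply: nb; rewrite inE h' orbT.
apply: (nbd (nb b (mem_head _ _)) _ _ (s := a)); last by rewrite fset3B.
- by rewrite fset3B; apply: hm; rewrite arc_cons mem_head.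
- by apply: hm; rewrite arc_cons inE; case: (m) => [|? ?]; rewrite mem_head orbT.
Qed.

Lemma star_all S x p q r r' : (forall b, ~ bd K S x b) ->
  fc K x p q -> fc S x p q -> fc K x r r' -> fc S x r r'.
Proof.
move=> nb /(tri_norm tK)[l lx] h; have [_ _ E] := lx; rewrite E.
have H : forall p' q', (p', q') \in arc_pairs p (q :: l) p -> fc S x p' q'.
  apply: star_chain => // p' q'; rewrite -pairs_cons => h'.
  by rewrite E /cedge h'.
rewrite /cedge pairs_cons => /orP[/H //|/H]; by rewrite fset3B.
Qed.

(** The part of the parity of boundary degrees that is used. With [xy] as the only boundary edge at
    [x], a full turn around [x] starting from a face of [S] at [xy] would put the other face at [xy]
    into [S] too. *)
Lemma bd_even S x y : bd K S x y -> exists2 y', y' != y & bd K S x y'.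
Proof.
move=> /bd_faces[s [t [h1 h2 h3 ts E]]].
apply: NNPP => n.
have h4 : fc K x y s by rewrite E eqxx.
have [l lx] := tri_norm tK h4.
have H : forall p' q', (p', q') \in arc_pairs y (s :: l) y -> fc S x p' q'.
  have [U _ El] := lx.
  apply: star_chain => [p' q'|b bl hb|//].
    by rewrite -pairs_cons El /cedge => ->.
  by case: n; exists b => //; apply: contraTneq bl => ->; move: U => /andP[].
have tl : t == last s l by move: h3; rewrite (lk_next _ lx) (negbTE ts).
case/negP: h2; rewrite fset3B; apply: H; rewrite arc_last //.
by move: lx => [+ _ _]; rewrite rcons_uniq /= => /andP[-> ->].
Qed.

(** Without boundary, [S] contains the full star of each vertex it meets, and the star at one end of
    an edge reaches the star at the other through a common face. Connectedness of the graph
    finishes. *)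
Lemma dual_connected S : S `<=` K -> S != fset0 -> (forall x y, ~ bd K S x y) -> S = K.
Proof.
move=> SK /fset0Pn[f fS] nb; apply/eqP; rewrite eqEfsubset SK; apply/fsubsetP=> g gK.
have [a [b [c [fE _]]]] := card3P (hK (fsubsetP SK _ fS)).
have [d [e [h [gE _]]]] := card3P (hK gK).
rewrite fE in fS; rewrite gE in gK *.
pose P v := forall r r', fc K v r r' -> fc S v r r'.
have Pa : P a by move=> r r' h'; apply: star_all h' => //; [exact: (fsubsetP SK _ fS)|].
have [|| p hp dE] := (let: And4 _ _ _ c := tK in c) a d.
- by apply/verticesP => //; exists b, c; apply: (fsubsetP SK).
- by apply/verticesP => //; exists e, h.
suff Pd : P d by apply: Pd.
rewrite -dE; elim: p a Pa hp {fS fE dE} => [|t p IH] a Pa //=.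
case/andP=> /(adjP _ _ hK)[r atr] hp; apply: IH => //.
have atrS := Pa _ _ atr; rewrite fset3A in atr atrS.
by move=> q q' h'; apply: star_all h' => //; [exact: atr|].
Qed.

Lemma bd_nonempty S : S `<=` K -> S != fset0 -> S != K -> exists x y, bd K S x y.
Proof.
move=> SK S0 /eqP SN; apply: NNPP => n; case: SN; apply: dual_connected => // x y h.
by apply: n; exists x, y.
Qed.

Lemma bd_diff A C : A `<=` C -> (forall p q, bd K A p q <-> bd K C p q) ->
  forall p q, ~ bd K (C `\` A) p q.
Proof.
move=> AC H p q [s [t []]]; rewrite !in_fsetD => hs ht /andP[sA sC].
rewrite negb_and negbK => /orP[tA|tC].
  have tC := fsubsetP AC _ tA.
  have /H/bd_faces[s' [t' [h1 h2 h3 h4 E]]] : bd K A p q by exists t, s.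
  have c0 r : fc C p q r -> fc K p q r -> r = s'.
    by move=> rC; rewrite E => /orP[/eqP //|/eqP e]; rewrite e (negbTE h2) in rC.
  by move: sA; rewrite (c0 s) // -(c0 t) // tA.
have /H/bd_faces[s' [t' [h1 h2 h3 h4 E]]] : bd K C p q by exists s, t.
have c0 r : ~~ fc A p q r -> fc K p q r -> r = t'.
  by move=> rC; rewrite E => /orP[/eqP e|/eqP //]; rewrite e h1 in rC.
have tA : ~~ fc A p q t by apply: contra tC; apply: (fsubsetP AC).
by move: tC; rewrite (c0 t) // -(c0 s) // sC.
Qed.

(** The disks of the argument. Nothing beyond the boundary is required, so either side of a 3-cycle
    qualifies. *)
Definition bounds (S : complex) (t : {fset nat}) := [/\ S `<=` K, #|` t| = 3
  & forall p q, bd K S p q <-> [/\ p != q, p \in t & q \in t]].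

Lemma bd_neq S p q : bd K S p q -> p != q.
Proof. by case=> s [t [/(fc_neq hK)[]]]. Qed.

(** The boundary is nonempty by [dual_connected] and never consists of one edge at a vertex; inside
    three vertices this leaves only the whole 3-cycle. *)
Lemma boundsI (S : complex) (t : {fset nat}) : #|` t| = 3 -> S `<=` K -> S != fset0 -> S != K ->
  (forall p q, bd K S p q -> p \in t /\ q \in t) -> bounds S t.
Proof.
move=> t3 SK S0 SN H; split=> // p q; split=> [h|].
  by have [? ?] := H _ _ h; have := bd_neq h.
have [a [b ab]] := bd_nonempty SK S0 SN.
have [aT bT] := H _ _ ab; have nab := bd_neq ab.
have [c nbc ac] := bd_even ab; have [_ cT] := H _ _ ac; have nac := bd_neq ac.
have /eqP tE : t == [fset a; b; c].
  rewrite eq_sym eqEfcard !fsubUset !fsub1set aT bT cT /= t3.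
  have /eqP -> : #|` [fset a; b; c]| == 3 by rewrite card3 /= !inE negb_or nab nac eq_sym nbc.
  by [].
have bc : bd K S b c.
  have [d nda bd'] := bd_even (bdC ab); have [_] := H _ _ bd'.
  rewrite tE !inE (negbTE nda) /= => /orP[/eqP e|/eqP <- //].
  by have := bd_neq bd'; rewrite e eqxx.
rewrite tE !inE => -[pq /orP[/orP[]|]/eqP pE /orP[/orP[]|]/eqP qE];
  move: pq; rewrite pE qE ?eqxx // => _; by [|apply: bdC].
Qed.

(** A face with a boundary edge outside [P] is removed together with that edge, which the third
    vertex bypasses, so the graph stays connected. Either all faces disappear, at the price of one
    edge each, or the process is stuck at a set whose entire boundary satisfies [P]. *)
Lemma collapse (P : pred {fset nat}) A E R : A `<=` K -> A != K ->
  (forall p q r, fc A p q r -> [fset p; q] \in E) -> cut (vertices K) E R ->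
  (exists A', [/\ A' `<=` A, A' != fset0 & forall p q, bd K A' p q -> P [fset p; q]]) \/
  (exists E2, [/\ E2 `<=` E, forall e, e \in E -> P e -> e \in E2,
                  (#|` E2| + #|` A| = #|` E|)%N & cut (vertices K) E2 R]).
Proof.
have [n] := ubnP #|` A|; elim: n A E => // n IH A E leN AK AN AE cE.
case: (classic (forall p q, bd K A p q -> P [fset p; q])) => [h|].
  case: (altP (A =P fset0)) => [->|A0]; last by left; exists A.
  by right; exists E; rewrite cardfs0 addn0.
move=> /not_all_ex_not[x /not_all_ex_not[y h]].
have xyA : bd K A x y by apply: NNPP => n'; apply: h.
have nP : ~~ P [fset x; y] by apply/negP=> h'; apply: h.
have [s [t [sA tA tK' ts Er]]] := bd_faces xyA.
have sK := fsubsetP AK _ sA; have [xy xs ys] := fc_neq hK sK.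
pose f := [fset x; y; s].
have cA : #|` A| = (#|` A `\ f|).+1 by rewrite (cardfsD1 f) sA.
have sub : A `\ f `<=` A by apply: fsubsetDl.
have AxsE : [fset x; s] \in E by apply: (AE _ _ y); rewrite fset3B.
have AysE : [fset y; s] \in E by apply: (AE _ _ x); rewrite fset3B fset3A.
have AxyE : [fset x; y] \in E by apply: (AE _ _ s).
have [||||| [A' [h1 h2 h3]]|[E2 [h1 h2 h3 h4]]] := IH (A `\ f) (E `\ [fset x; y]).
- by move: leN; rewrite cA ltnS.
- exact: fsubset_trans sub AK.
- by apply: contraNneq tA => e; apply: (fsubsetP sub); rewrite e.
(* As [xy] is a boundary edge, [f] is the only face of [A] containing it; the remaining faces do not
   use the deleted edge. *)
- move=> p q r; rewrite !inE => /andP[nf rA]; rewrite (AE _ _ _ rA) andbT.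
  apply: contraNneq nf => e; have rA' : fc A x y r by rewrite -e.
  have := fsubsetP AK _ rA'; rewrite Er => /orP[/eqP->|/eqP re].
    by rewrite e.
  by move: tA; rewrite -re rA'.
- apply: (cut_remove (s := s)) => //; first by rewrite /= !inE negb_or xy xs ys.
  by apply/verticesP => //; exists x, y; fcp.
- by left; exists A'; split=> //; apply: fsubset_trans sub.
right; exists E2; split=> //.
- by apply: fsubset_trans h1 _; apply: fsubsetDl.
- move=> e eE Pe; apply: h2 => //; rewrite !inE eE andbT.
  by apply: contraNneq nP => <-.
- by rewrite cA addnS h3 [RHS](cardfsD1 [fset x; y]) AxyE.
Qed.

Lemma cut_edges R x : x \in R -> x \in vertices K -> cut (vertices K) (edges K) R.
Proof.
move=> xR xK R' sub [v vK vR].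
have xR' := fsubsetP sub _ xR.
have [p] := (let: And4 _ _ _ c := tK in c) x v xK vK.
elim: p x xR' {xR xK} => [|t p IH] x xR' /=; first by move=> _ e; rewrite -e xR' in vR.
case/andP=> xt hp hl; have [tR|tR] := boolP (t \in R'); first exact: IH tR hp hl.
exists t, x; split=> //; first by rewrite fsetUC.
have [r xtr] := (adjP x t hK).1 xt; apply/verticesP => //; exists x, r.
by rewrite fset3A.
Qed.

Hypothesis eK : (#|` vertices K| + #|` K| = #|` edges K| + 2)%N.

(* Jordan: were the faces of [K] minus one connected across edges outside [t],
   collapsing them would leave a connected graph with as many edges as a tree,
   which contains the 3-cycle [t]. *)
Lemma jordan (t : {fset nat}) : #|` t| = 3 ->
  (forall p q, p \in t -> q \in t -> p != q -> adj K p q) -> exists S, bounds S t.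
Proof.
move=> t3 tadj; have [x [y [z [tE U]]]] := card3P t3.
have [/fset0Pn[f0 f0K] _ _ _] := tK.
have /and3P[xy xz yz] : [&& x != y, x != z & y != z].
  by move: U; rewrite /= !inE negb_or andbT -andbA.
have [xt yt zt] : [/\ x \in t, y \in t & z \in t] by rewrite tE !inE !eqxx !orbT.
have vK p q : adj K p q -> p \in vertices K.
  by case/(adjP _ _ hK)=> r h; apply/verticesP => //; exists q, r.
have sub : K `\ f0 `<=` K by apply: fsubsetDl.
(* The sides of [t] are protected, so a set of faces at which the collapse is stuck is the disk
   sought. *)
case: (@collapse (fun e => e `<=` t) (K `\ f0) (edges K) [fset x]) => //.
- by apply: contraTneq f0K => <-; rewrite !inE eqxx.
- by move=> p q r /(fsubsetP sub); apply: fc_adj.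
- apply: (@cut_edges _ x); rewrite ?inE //; apply: (vK _ y); exact: tadj.
- case=> A' [h1 h2 h3]; exists A'; apply: boundsI => //.
  + exact: fsubset_trans sub.
  + by apply: contraTneq h1 => ->; apply/fsubsetPn; exists f0; rewrite // !inE eqxx.
  + by move=> p q /h3; rewrite fsubUset !fsub1set => /andP[].
case=> E2 [h1 h2 h3 h4]; exfalso.
have inE2 p q : p \in t -> q \in t -> p != q -> [fset p; q] \in E2.
  by move=> pt qt pq; apply: h2; [exact: tadj|rewrite fsubUset !fsub1set pt qt].
have := cut_remove h4 U (vK _ _ (tadj _ _ zt xt ltac:(by rewrite eq_sym)))
  (inE2 _ _ xt zt xz) (inE2 _ _ yt zt yz).
move=> /cut_count; have xK := vK _ _ (tadj _ _ xt yt xy).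
have := cardfsD1 x (vertices K); rewrite xK.
have := cardfsD1 f0 K; rewrite f0K.
have := cardfsD1 [fset x; y] E2; rewrite inE2 //.
have : #|` [fset e in E2 `\ [fset x; y] | ~~ (e `<=` [fset x])]| <= #|` E2 `\ [fset x; y]|.
  by apply: fsubset_leq_card; apply/fsubsetP=> e; rewrite !inE /= => /andP[].
move: h3 eK; lia.
Qed.

Lemma edges_sub S : S `<=` K -> edges S `<=` edges K.
Proof.
move=> SK; have hS : pure S by move=> f /(fsubsetP SK)/hK.
apply/fsubsetP=> e /(edgesP _ hS)[a [b [c [-> abc]]]].
by apply/edgesP => //; exists a, b, c; split=> //; apply: (fsubsetP SK).
Qed.

Lemma vertices_sub S : S `<=` K -> vertices S `<=` vertices K.
Proof.
move=> SK; have hS : pure S by move=> f /(fsubsetP SK)/hK.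
apply/fsubsetP=> e /(verticesP _ hS)[a [b abc]].
by apply/verticesP => //; exists a, b; apply: (fsubsetP SK).
Qed.

Lemma bounds_compl S t : bounds S t -> bounds (K `\` S) t.
Proof.
case=> SK t3 H; split=> //; first exact: fsubsetDl.
move=> p q; rewrite -H; split; first exact: bd_compl.
by rewrite -{1}(fsetDK SK); apply: bd_compl.
Qed.

(** By cancellation [S] minus [A] has no boundary, so it is empty or all of [K]; in the latter case
    [A] would be empty and could not bound [t]. *)
Lemma bounds_sub S A t : bounds S t -> bounds A t -> A `<=` S -> A = S.
Proof.
case=> SK t3 H [AK _ H'] AS; apply/eqP; rewrite eqEfsubset AS -fsetD_eq0.
apply/negPn/negP=> n; have E : S `\` A = K.
  apply: dual_connected => //; first exact: fsubset_trans (fsubsetDl _ _) SK.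
  by apply: bd_diff => // p q; rewrite H H'.
have A0 : A = fset0.
  apply/fsetP=> f; rewrite in_fset0; apply/negbTE/negP=> fA.
  by have := fsubsetP AK _ fA; rewrite -E in_fsetD fA.
have [x [y [z [tE U]]]] := card3P t3.
have [s [r []]] : bd K A x y.
  apply/H'; rewrite tE !inE !eqxx orbT; split=> //.
  by move: U; rewrite /= !inE negb_or -andbA => /andP[].
by rewrite A0.
Qed.

Lemma bounds_neq S t : bounds S t -> S != fset0 /\ S != K.
Proof.
case=> SK t3 H; have [x [y [z [tE U]]]] := card3P t3.
have /bd_faces[s [r [h1 h2 h3 _ _]]] : bd K S x y.
  apply/H; rewrite tE !inE !eqxx orbT; split=> //.
  by move: U; rewrite /= !inE negb_or -andbA => /andP[].
split; first by apply/fset0Pn; eexists; exact: h1.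
by apply: contraNneq h2 => ->.
Qed.

(** Only this half of Euler's formula is needed. All faces outside [S] but one collapse while the
    edges of [S] are kept: a stuck set would bound [t] and hence be the whole complement, [f0]
    included. The surviving edges outside [S] are then at least as many as the vertices outside [S],
    and Euler's relation on [K] gives the rest. *)
Lemma disk_euler S t : bounds S t ->
  #|` edges S| + 1 <= #|` vertices S| + #|` S|.
Proof.
move=> B; have [SK t3 H] := B; have hS : pure S by move=> f /(fsubsetP SK)/hK.
have BC := bounds_compl B; have [C0 _] := bounds_neq BC.
have [/fset0Pn[g gS] _] := bounds_neq B.
case/fset0Pn: C0 => f0 f0C; pose C := K `\` S.
have sub : C `\ f0 `<=` C by apply: fsubsetDl.
have subK : C `\ f0 `<=` K by apply: fsubset_trans sub _; apply: fsubsetDl.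
have f0K : f0 \in K by move: f0C; rewrite in_fsetD => /andP[].
have [a [b [c [gE _]]]] := card3P (hS _ gS).
have aS : a \in vertices S by apply/verticesP => //; exists b, c; rewrite -gE.
case: (@collapse (fun e => e \in edges S) (C `\ f0) (edges K) (vertices S)) => //.
- by apply: contraTneq f0K => <-; rewrite !inE eqxx.
- by move=> p q r /(fsubsetP subK); apply: fc_adj.
- by apply: (@cut_edges _ a) => //; apply: (fsubsetP (vertices_sub SK)).
- case=> A' [h1 h2 h3]; exfalso; have BA : bounds A' t.
    apply: boundsI => //.
    + exact: fsubset_trans subK.
    + by apply: contraTneq h1 => ->; apply/fsubsetPn; exists f0; rewrite // !inE eqxx.
    + move=> p q h; have /(edgesP _ hS)[a' [b' [c' [E abc]]]] := h3 _ _ h.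
      rewrite -E in abc.
      have [s [r [k1 k2 k3 _]]] := h.
      have : fc C p q s by apply: (fsubsetP sub); apply: (fsubsetP h1).
      rewrite in_fsetD => /andP[nS _].
      have /H[] : bd K S p q.
        by exists c', s; split=> //; apply: (fsubsetP SK).
      by [].
  have := bounds_sub BC BA (fsubset_trans h1 sub) => e.
  by move/fsubsetP: h1 => /(_ f0); rewrite e f0C !inE eqxx => /(_ isT).
case=> E2 [h1 h2 h3 h4]; have := cut_count h4.
have sE2 : edges S `<=` E2.
  by apply/fsubsetP=> e eS; apply: h2 => //; apply: (fsubsetP (edges_sub SK)).
have : #|` [fset e in E2 | ~~ (e `<=` vertices S)]| <= #|` E2 `\` edges S|.
  apply: fsubset_leq_card; apply/fsubsetP=> e; rewrite !inE /= => /andP[-> n].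
  rewrite andbT; apply: contra n => /(edgesP _ hS)[p [q [r [-> pqr]]]].
  rewrite fsubUset !fsub1set; apply/andP; split; apply/verticesP => //.
    by exists q, r.
  by exists p, r; rewrite fset3A.
rewrite !cardfsDS ?vertices_sub //.
have := fsubset_leq_card sE2; have := fsubset_leq_card (vertices_sub SK).
have cC : #|` C| = (#|` K| - #|` S|)%N by rewrite /C cardfsDS.
have := cardfsD1 f0 C; rewrite f0C; have := fsubset_leq_card SK.
move: h3 eK cC; lia.
Qed.

End Topology.

(** * Counting *)

Lemma card_sep (T : choiceType) (Y : {fset T}) (P : pred T) :
  #|` [fset y in Y | P y]| = \sum_(y <- Y) P y.
Proof.
have -> : \sum_(y <- Y) P y = count P Y.
  by rewrite -sum1_count [RHS]big_mkcond; apply: eq_bigr => y _; case: (P y).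
rewrite -size_filter; apply: perm_size; apply: uniq_perm.
- exact: fset_uniq.
- by rewrite filter_uniq.
- by move=> y; rewrite mem_filter !inE /= andbC.
Qed.

Lemma double_count (T T' : choiceType) (X : {fset T}) (Y : {fset T'}) (r : T -> T' -> bool) :
  \sum_(x <- X) #|` [fset y in Y | r x y]| = \sum_(y <- Y) #|` [fset x in X | r x y]|.
Proof.
under eq_bigr do rewrite card_sep; rewrite exchange_big /=.
by under [RHS]eq_bigr do rewrite card_sep.
Qed.

Lemma sum_fset_const (T : choiceType) (X : {fset T}) (F : T -> nat) n :
  (forall x, x \in X -> F x = n) -> \sum_(x <- X) F x = (n * #|` X|)%N.
Proof.
move=> h; rewrite big_seq_cond (eq_bigr (fun=> n)); last by move=> x /andP[/h].
by rewrite -big_seq_cond big_const_seq iter_addn_0 count_predT.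
Qed.

(** Incidences of edges and faces: three for each face, two for each edge, but only one for the
    edges in [B]. *)
Lemma count_edges S B : pure S -> B `<=` edges S ->
  (forall e, e \in edges S -> (#|` [fset f in S | e `<=` f]| + (e \in B) = 2)%N) ->
  (3 * #|` S| + #|` B| = 2 * #|` edges S|)%N.
Proof.
move=> hS BS h.
have := double_count (edges S) S (fun e f => e `<=` f).
rewrite [RHS](@sum_fset_const _ _ _ 3) => [<-|f fS].
  have -> : #|` B| = \sum_(e <- edges S) (e \in B).
    rewrite -card_sep; congr (#|` _|); apply/fsetP=> e; rewrite !inE /=.
    by case eB: (e \in B); rewrite ?andbF // (fsubsetP BS).
  by rewrite -big_split /=; apply: sum_fset_const.
have [a [b [c [fE U]]]] := card3P (hS _ fS).
have /and3P[ab ac bc] : [&& a != b, a != c & b != c].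
  by move: U; rewrite /= !inE negb_or andbT -andbA.
rewrite fE in fS *.
have -> : [fset x in edges S | x `<=` [fset a; b; c]] =
    [fset [fset a; b]; [fset a; c]; [fset b; c]].
  apply/fsetP=> e; rewrite !inE /=; apply/andP/idP.
    case=> /(edgesP _ hS)[p [q [r [-> /(fc_neq hS)[pq _ _]]]]].
    rewrite fsubUset !fsub1set !inE !eq2 => /andP[/orP[/orP[]|]/eqP pE /orP[/orP[]|]/eqP qE];
    by move: pq; rewrite pE qE !eqxx ?orbT.
  case/orP=> [/orP[]|] /eqP->; rewrite fsubUset !fsub1set !inE !eqxx ?orbT; split=> //;
    apply/(edgesP _ hS).
  - by exists a, b, c.
  - by exists a, c, b; rewrite fset3B.
  - by exists b, c, a; split=> //; fcp.
rewrite 2!cardfsU1r cardfs1 !inE !eq2.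
by rewrite !(neqF ab, neqF ac, neqF bc) ?eqxx ?andbF.
Qed.

Lemma uniq_pairs c : uniq c -> uniq (pairs c).
Proof. exact: zip_uniql. Qed.

Lemma pairs_asym c p q : uniq c -> 3 <= size c ->
  (p, q) \in pairs c -> (q, p) \notin pairs c.
Proof.
move=> U sz pq; have pc : p \in c by move: pq; rewrite mem_pairs_next // => /andP[].
have [i s E] := rot_to pc; move: pq.
rewrite -!(mem_rot i (pairs c)) -pairs_rot E.
have Us : uniq (p :: s) by rewrite -E rot_uniq.
have szs : 3 <= size (p :: s) by rewrite -E size_rot.
case: s Us szs {E} => [|a [|b s]] // Us _.
rewrite pairs_cons arc_last; last by rewrite rcons_uniq.
rewrite arc_cons inE xpair_eqE eqxx /= => /orP[/eqP->|h].
  move: Us => /= /andP[_ /andP[n _]]; apply: contra n => /eqP->.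
  by rewrite mem_last.
by have /andP[h' _] := mem_arc h; move: Us => /andP[]; rewrite h'.
Qed.

(** * Degrees, colours and inner vertices of degree 4 *)

Section Degrees.
Variable K : complex.
Hypothesis tK : triangulation K.
Let hK := tri_pure tK.

Lemma face_sub p q f : f \in K -> p != q -> [fset p; q] `<=` f ->
  exists r, f = [fset p; q; r].
Proof.
move=> fK pq; rewrite fsubUset !fsub1set => /andP[pf qf].
have [a [b [fE _]]] := card3_at (hK fK) pf; rewrite fE in qf *.
move: qf; rewrite !inE (eq_sym q) (negbTE pq) /= => /orP[]/eqP->.
  by exists b.
by exists a; rewrite fset3B.
Qed.

Lemma faces_at_edge (S : complex) p q s t : S `<=` K ->
  fc K p q s -> fc K p q t -> t != s -> fc S p q s ->
  #|` [fset f in S | [fset p; q] `<=` f]| = (1 + fc S p q t)%N.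
Proof.
move=> SK h1 h2 ts h3; have [pq _ _] := fc_neq hK h1.
have [t' nt E] := edge_faces tK h1.
have tE : t = t' by move: h2; rewrite E (negbTE ts) => /eqP.
have sub r : [fset p; q] `<=` [fset p; q; r] by rewrite fsubsetUl.
have in_ f : f \in S -> [fset p; q] `<=` f ->
    f = [fset p; q; s] \/ f = [fset p; q; t] .
  move=> fS /(face_sub (fsubsetP SK _ fS) pq)[r fE].
  have := fsubsetP SK _ fS; rewrite fE E -tE => /orP[]/eqP->; by [left|right].
case St: (fc S p q t).
  have -> : [fset f in S | [fset p; q] `<=` f] = [fset [fset p; q; s]; [fset p; q; t]].
    apply/fsetP=> f; rewrite !inE /=; apply/andP/orP.
      by case=> fS /(in_ _ fS)[]->; rewrite eqxx; [left|right].
    by case=> /eqP->; rewrite sub ?h3 ?St.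
  rewrite cardfs2.
  have U := fc_uniq hK h2; rewrite eq3 //; have [_ ps qs] := fc_neq hK h1.
  by simpneq; rewrite ?andbF.
have -> : [fset f in S | [fset p; q] `<=` f] = [fset [fset p; q; s]].
  apply/fsetP=> f; rewrite !inE /=; apply/andP/idP.
    case=> fS /(in_ _ fS)[]fE; first by rewrite fE.
    by rewrite fE St in fS.
  by move/eqP->; rewrite sub h3.
by rewrite cardfs1.
Qed.

Lemma triangulation_edges : (3 * #|` K| = 2 * #|` edges K|)%N.
Proof.
rewrite -(@count_edges K fset0) ?cardfs0 ?addn0 // ?fsub0set // => e.
case/(edgesP _ hK)=> p [q [s [-> pqs]]].
have [t ts E] := edge_faces tK pqs.
have pqt : fc K p q t by rewrite E eqxx orbT.
by rewrite (@faces_at_edge K p q s t) // pqt in_fset0.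
Qed.

(** With edges eliminated, a move preserves the sphere because it changes one vertex and two
    faces. *)
Lemma sphere_count : (#|` vertices K| + #|` K| = #|` edges K| + 2)%N <->
  (2 * #|` vertices K| = #|` K| + 4)%N.
Proof. have := triangulation_edges; lia. Qed.

Lemma bounds_edges S t : bounds K S t -> (3 * #|` S| + 3 = 2 * #|` edges S|)%N.
Proof.
case=> SK t3 H; have hS : pure S by move=> f /(fsubsetP SK)/hK.
have [x [y [z [tE U]]]] := card3P t3.
have /and3P[xy xz yz] : [&& x != y, x != z & y != z].
  by move: U; rewrite /= !inE negb_or andbT -andbA.
pose B := [fset [fset x; y]; [fset x; z]; [fset y; z]].
have inB p q : p != q -> ([fset p; q] \in B) = (p \in t) && (q \in t).
  move=> pq; rewrite !inE !eq2 tE !inE; apply/idP/idP.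
    by move=> /orP[/orP[]|] /orP[]/andP[/eqP-> /eqP->]; rewrite !eqxx ?orbT.
  case/andP=> /orP[/orP[]|]/eqP pE /orP[/orP[]|]/eqP qE;
    by move: pq; rewrite pE qE !eqxx ?orbT.
have cB : #|` B| = 3.
  rewrite 2!cardfsU1r cardfs1 !inE !eq2.
  by rewrite !(neqF xy, neqF xz, neqF yz) ?eqxx ?andbF.
rewrite -(@count_edges S B) ?cB // => [|e].
  apply/fsubsetP=> e eB; have [p [q [pq eE]]] : exists p q, p != q /\ e = [fset p; q].
    by move: eB; rewrite !inE => /orP[/orP[]|] /eqP->; [exists x, y|exists x, z|exists y, z].
  move: eB; rewrite eE inB // => /andP[pt qt].
  have /(bd_faces tK)[s [r [h1 _ _ _ _]]] : bd K S p q by apply/H.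
  by apply/(edgesP _ hS); exists p, q, s.
case/(edgesP _ hS)=> p [q [s [-> pqs]]].
have pqs' := fsubsetP SK _ pqs; have [pq _ _] := fc_neq hK pqs'.
have [r rs E] := edge_faces tK pqs'.
have pqr : fc K p q r by rewrite E eqxx orbT.
rewrite (@faces_at_edge S p q s r) // inB //.
case: (boolP ((p \in t) && (q \in t))) => [/andP[pt qt]|n].
  have /(bd_faces tK)[s' [r' [h1 h2 h3 h4 E']]] : bd K S p q by apply/H.
  have es : s = s' by move: pqs'; rewrite E' => /orP[/eqP //|/eqP es]; rewrite -es pqs in h2.
  have er : r = r' by move: pqr; rewrite E' -es (negbTE rs) => /eqP.
  by rewrite er (negbTE h2).
case Sr: (fc S p q r) => //; case/negP: n; apply/andP.
have /H[] // : bd K S p q by exists s, r; rewrite Sr.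
Qed.

Lemma sum_degrees S : pure S ->
  \sum_(v <- vertices S) #|` [fset f in S | v \in f]| = (3 * #|` S|)%N.
Proof.
move=> hS; rewrite (double_count (vertices S) S (fun v f => v \in f)).
apply: sum_fset_const => f fS; rewrite -(hS _ fS); congr (#|` _|).
apply/fsetP=> v; rewrite !inE /=; case vf: (v \in f); last by rewrite andbF.
rewrite andbT; apply/(verticesP _ hS).
by have [a [b [fE _]]] := card3_at (hS _ fS) vf; exists a, b; rewrite -fE.
Qed.

Lemma degree_ge (S : complex) v c : lk K v c -> (forall p q, fc K v p q -> fc S v p q) ->
  size c <= #|` [fset f in S | v \in f]|.
Proof.
move=> lc h; have [U sz E] := lc; pose F (e : nat * nat) := [fset v; e.1; e.2].
have -> : size c = size (map F (pairs c)) by rewrite size_map size_zip size_rot minnn.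
have pK p q : (p, q) \in pairs c -> fc K v p q by move=> h'; rewrite E /cedge h'.
apply: uniq_leq_size.
  rewrite map_inj_in_uniq ?uniq_pairs // => -[p q] [p' q'] /= h1 h2 /eqP.
  rewrite /F /= eq3_at; last exact: fc_uniq hK (pK _ _ h2).
  case/orP=> /andP[/eqP e1 /eqP e2]; first by rewrite e1 e2.
  by subst p q; case/negP: (pairs_asym U sz h1).
move=> f /mapP[[p q] h' ->]; rewrite !inE /= eqxx andbT.
by apply/h/pK.
Qed.

Definition deg4 v := exists a b c d, lk K v [:: a; b; c; d].

Variable col : nat -> 'I_3.
Hypothesis hcol : forall x y, adj K x y -> col x <> col y.

Lemma col_face a b c : fc K a b c -> col a != col b.
Proof. by move=> h; apply/eqP/hcol; apply: fc_adj h. Qed.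

Lemma color_alternates (g : pred nat) a m e :
  (forall p q, (p, q) \in arc_pairs a m e -> g p = ~~ g q) ->
  g a = g e (+) odd (size m).+1.
Proof.
elim: m a => [|b m IH] a h /=.
  by rewrite addbT; apply: h; rewrite /arc_pairs mem_head.
have -> : g a = ~~ g b by apply: h; rewrite arc_cons mem_head.
rewrite (IH b) => [|p q hpq]; first by rewrite /= !addbN.
by apply: h; rewrite arc_cons inE hpq orbT.
Qed.

(** Around [v] the two colours different from that of [v] alternate. *)
Lemma lk_even v c : lk K v c -> ~~ odd (size c).
Proof.
move=> l; have [_ + E] := l; case: c l E => // a m l E _.
have := @color_alternates (fun s => col s == col a) a m a.
rewrite eqxx => /(_ _)/esym; rewrite /= => h.
suff : true (+) ~~ odd (size m) by rewrite addTb negbK.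
apply: h => p q hpq.
have vpq : fc K v p q by rewrite E /cedge pairs_cons hpq.
have va : exists r, fc K v a r by apply: lk_mem l _; rewrite mem_head.
have [r var] := va.
have n1 : col v != col p by apply: col_face vpq.
have n2 : col v != col q by apply: (@col_face _ _ p); fcp.
have n3 : col p != col q by apply: (@col_face _ _ v); fcp.
have n4 : col v != col a by apply: col_face var.
move: n1 n2 n3 n4; rewrite -!val_eqE /=.
by case: (col v) (col p) (col q) (col a) => [x hx] [y hy] [z hz] [t ht] /=; lia.
Qed.

Lemma lk_size4 v c : lk K v c -> size c = 4 -> deg4 v.
Proof. by case: c => [|a [|b [|c [|d [|]]]]] // l _; exists a, b, c, d. Qed.

(** The single face [t] bounds the same 3-cycle and lies in [S], so [bounds_sub] identifies the
    two. *)
Lemma bounds_face S t : bounds K S t -> t \in S -> S = [fset t].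
Proof.
move=> B tS; apply/esym; apply: (bounds_sub tK B); last by rewrite fsub1set.
have B' := B; case: B => SK t3 H.
apply: boundsI => //; rewrite ?fsub1set ?(fsubsetP SK) //.
- by apply/fset0Pn; exists t; rewrite inE.
- apply: contraNneq (bounds_neq tK B').2 => e.
  by rewrite eqEfsubset SK -e fsub1set.
move=> p q [s [r [_ _]]]; rewrite !inE => /eqP <- _.
by rewrite !inE !eqxx ?orbT.
Qed.

(** Otherwise each inner vertex has even degree at least 6, and each vertex of [t] lies in at least
    two faces of [S]. Writing V, E, F for the counts in [S], this gives 3F + 12 >= 6V, whereas 3F +
    3 = 2E and E + 1 <= V + F give 3F + 15 <= 6V. *)
Lemma interior_deg4 S t : bounds K S t -> 1 < #|` S| ->
  (#|` vertices K| + #|` K| = #|` edges K| + 2)%N ->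
  exists2 u, u \in vertices S `\` t & deg4 u.
Proof.
move=> B S2 eK; apply: NNPP => n; have [SK t3 H] := B.
have hS : pure S by move=> f /(fsubsetP SK)/hK.
have tS : t \notin S.
  by apply: contraL S2 => /(bounds_face B) ->; rewrite cardfs1.
(* The faces of [S] along the two sides of [t] at [v] differ: a common face would be [t] itself. *)
have tE v : v \in t -> exists a b r r',
    [/\ [fset v; a; r] != [fset v; b; r'], fc S v a r & fc S v b r'].
  move=> vt; have [a [b [E U]]] := card3_at t3 vt; exists a, b.
  have /and3P[va vb ab] : [&& v != a, v != b & a != b].
    by move: U; rewrite /= !inE negb_or andbT -andbA.
  have /(bd_faces tK)[s [_ [h1 _ _ _ _]]] : bd K S v a.
    by apply/H; rewrite E !inE !eqxx ?orbT.
  have /(bd_faces tK)[s' [_ [h2 _ _ _ _]]] : bd K S v b.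
    by apply/H; rewrite E !inE !eqxx ?orbT.
  exists s, s'; split=> //; apply: contraNneq tS => e.
  have : b \in [fset v; a; s] by rewrite e !inE eqxx orbT.
  rewrite !inE (eq_sym b v) (negbTE vb) (eq_sym b a) (negbTE ab) /= => /eqP bs.
  by rewrite E bs.
have tV v : v \in t -> v \in vertices S.
  move=> /tE[a [b [r [r' [_ h _]]]]]; apply/(verticesP _ hS); by exists a, r.
have := disk_euler tK eK B; have := bounds_edges B; have := sum_degrees hS.
(* A vertex of [t] is sure of only two faces in [S]; the added 4 brings it up to 6. *)
have : 6 * #|` vertices S| <= \sum_(v <- vertices S) (#|` [fset f in S | v \in f]| + 4 * (v \in t)).
  rewrite -(@sum_fset_const _ _ (fun=> 6) 6) // [X in X <= _]big_seq_cond [X in _ <= X]big_seq_cond.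
  apply: leq_sum => v /andP[vS _]; case: (boolP (v \in t)) => [/tE|vt].
    case=> a [b [r [r' [ne h1 h2]]]]; rewrite muln1 (leq_add2r 4 2) //.
    have := cardfs2 [fset v; a; r] [fset v; b; r']; rewrite ne => <-.
    apply: fsubset_leq_card; apply/fsubsetP=> f; rewrite !inE => /orP[]/eqP->;
    by rewrite /= ?h1 ?h2 !inE eqxx.
  have /(verticesP _ hS)[p [q vpq]] := vS; have vpq' := fsubsetP SK _ vpq.
  have [c lc] := tri_lk tK vpq'.
  rewrite muln0 addn0; apply: leq_trans (degree_ge lc _).
    have := lk_even lc; have [_ sz _] := lc.
    have : size c <> 4.
      by move=> c4; case: n; exists v; [rewrite in_fsetD vt|apply: lk_size4 lc c4].
    lia.
  move=> p' q'; apply: (star_all tK _ vpq' vpq) => b /H[_ h _].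
  by rewrite h in vt.
rewrite big_split /=.
have -> : \sum_(v <- vertices S) (4 * (v \in t)) = 12.
  rewrite -big_distrr /= -card_sep.
  have -> : [fset y in vertices S | y \in t] = t; last by rewrite t3.
  by apply/fsetP=> y; rewrite !inE /=; case yt: (y \in t); rewrite ?andbF // tV.
lia.
Qed.

End Degrees.

(** * Triangulations without contractible configuration *)

Lemma lk4_faces K u a b c d : lk K u [:: a; b; c; d] ->
  [/\ fc K u a b, fc K u b c, fc K u c d & fc K u d a].
Proof.
by case=> _ _ E; rewrite !E /cedge /pairs /= !inE !eqxx !orbT.
Qed.

Lemma lk4_norm K u a b c d p q : lk K u [:: a; b; c; d] -> fc K u p q ->
  exists c' d', lk K u [:: p; q; c'; d'].
Proof.
move=> l; have [_ _ E] := l; rewrite E /cedge /pairs /= !inE !xpair_eqE.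
have l1 := lk_rot 1 l; have l2 := lk_rot 2 l; have l3 := lk_rot 3 l.
have r0 := lk_rev l; have r1 := lk_rot 1 r0; have r2 := lk_rot 2 r0.
have r3 := lk_rot 3 r0; rewrite /rot /rev /= in l1 l2 l3 r0 r1 r2 r3.
case/orP=> /or4P[] /andP[/eqP e1 /eqP e2]; rewrite e1 e2.
- by exists c, d.
- by exists d, a.
- by exists a, b.
- by exists b, c.
- by exists d, c.
- by exists a, d.
- by exists b, a.
- by exists c, b.
Qed.

Lemma lk4_swap K u a b c d : lk K u [:: a; b; c; d] -> lk K u [:: b; a; d; c].
Proof. by move/lk_rev/(lk_rot 2). Qed.

Lemma deg4_closed K q x1 x2 x3 x4 : deg4 K q -> fc K q x1 x2 -> fc K q x2 x3 ->
  fc K q x3 x4 -> x1 != x3 -> x2 != x4 -> lk K q [:: x1; x2; x3; x4].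
Proof.
case=> [a [b [c [d l]]]] h1 h2 h3 n1 n2; have [e [f l']] := lk4_norm l h1.
have := lk_next x3 (lk_rot 1 l'); rewrite /rot /= h2 (eq_sym x3 x1) (negbTE n1) orbF.
move=> /esym/eqP e3; rewrite -e3 in l' *.
have := lk_next x4 (lk_rot 2 l'); rewrite /rot /= h3 (eq_sym x4 x2) (negbTE n2) orbF.
by move=> /esym/eqP e4; rewrite e4.
Qed.

Definition bip (a c : nat) (p : seq nat) : complex :=
  [fset [fset a; e.1; e.2] | e in pairs p] `|` [fset [fset c; e.1; e.2] | e in pairs p].

Section Irreducible.
Variables (K : complex) (col : nat -> 'I_3).
Hypothesis tK : triangulation K.
Hypothesis eK : (#|` vertices K| + #|` K| = #|` edges K| + 2)%N.
Hypothesis hcol : forall x y, adj K x y -> col x <> col y.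
Hypothesis irr : forall u v w x y z, ~ contractible K u v w x y z.
Let hK := tri_pure tK.

Lemma col3 a b c d : fc K a b c -> fc K b c d -> col a = col d.
Proof.
move=> h1 h2.
have n1 : col a != col b := col_face tK hcol h1.
have n2 : col b != col c := col_face tK hcol h2.
have n3 : col a != col c by apply: (col_face tK hcol (c := b)); fcp.
have n4 : col b != col d by apply: (col_face tK hcol (c := c)); fcp.
have n5 : col c != col d by apply: (col_face tK hcol (c := b)); fcp.
apply: val_inj; move: n1 n2 n3 n4 n5; rewrite -!val_eqE /=.
by case: (col a) (col b) (col c) (col d) => [x hx] [y hy] [z hz] [t ht] /=; lia.
Qed.

Lemma col_neq a b c d : fc K a b c -> col d = col a -> d != b.
Proof.
by move=> h e; apply: contraNneq (col_face tK hcol h) => <-; rewrite e.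
Qed.

(** The colours make [v] different from [c] and [d], so the only remaining obstacle to contracting
    [u] across [ab] is an edge from [v] to one of them. *)
Lemma blocked u a b c d v : lk K u [:: a; b; c; d] -> fc K a b v -> v != u ->
  adj K v c \/ adj K v d.
Proof.
move=> l abv vu; have [h1 h2 h3 h4] := lk4_faces l.
have cv : col v = col u by apply: (@col3 _ a b); fcp.
have vc : v != c by apply: col_neq h3 cv.
have vd : v != d by apply: col_neq h4 cv.
case E1: (adj K v c); first by left.
case E2: (adj K v d); first by right.
case: (@irr u v b c d a); split; rewrite ?E1 ?E2 //; last by fcp.
have [Ul _ _] := l; uniqF Ul.
have [ua ub _] := fc_neq hK h1; have [uc ud _] := fc_neq hK h3.
have [_ av bv] := fc_neq hK abv.
by rewrite /= !inE !negb_or; simpneq.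
Qed.

Lemma deg4_next u a b c d v : lk K u [:: a; b; c; d] -> fc K a b v -> v != u ->
  fc K v b c -> lk K b [:: u; a; v; c].
Proof.
move=> l abv vu vbc; have [h1 h2 h3 h4] := lk4_faces l.
have [Ul _ _] := l; uniqF Ul.
by apply: tri_closed4 => //; try fcp; rewrite eq_sym.
Qed.

Lemma minimal_disk : exists S t, [/\ bounds K S t, 1 < #|` S|
  & forall S' t', bounds K S' t' -> 1 < #|` S'| -> #|` S| <= #|` S'|].
Proof.
have [S [t [B S2]]] : exists S t, bounds K S t /\ 1 < #|` S|.
  have [/fset0Pn[f fK] _ _ _] := tK.
  have [a [b [c [fE _]]]] := card3P (hK fK); rewrite fE in fK.
  have adjf p q := @face_adj K p q _ fK.
  have [S B] := jordan tK eK (hK fK) adjf.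
  have [S2|S2] := ltnP 1 #|` S|; first by exists S, [fset a; b; c].
  (* [S] has at most one face here. A link already provides three faces of [K], so the complement
     has at least two. *)
  exists (K `\` S), [fset a; b; c]; split; first exact: bounds_compl.
  have [SK _ _] := B; rewrite cardfsDS //.
  have [cy lc] := tri_lk tK fK; have [_ sz _] := lc.
  have c3 : 3 <= #|` K|.
    apply: leq_trans sz (leq_trans (degree_ge tK lc (fun _ _ h => h)) _).
    by apply: fsubset_leq_card; apply/fsubsetP=> g; rewrite !inE /= => /andP[].
  by move: S2 c3; clear; lia.
have [n] := ubnP #|` S|; elim: n S t B S2 => // n IH S t B S2 lt.
case: (classic (exists S' t', [/\ bounds K S' t', 1 < #|` S'| & #|` S'| < #|` S|])).
  by case=> S' [t' [B' S2' lt']]; apply: (IH S' t') => //; apply: leq_trans lt' _.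
move=> h; exists S, t; split=> // S' t' B' S2'; rewrite leqNgt; apply/negP=> lt'.
by apply: h; exists S', t'.
Qed.

Lemma bounds_uniq S t t1 : bounds K S t -> bounds K S t1 -> t1 = t.
Proof.
case=> _ t3 H [_ t13 H1]; apply/eqP; rewrite eqEfcard t3 t13 leqnn andbT.
apply/fsubsetP=> p pt; have [a [b [E U]]] := card3_at t13 pt.
have /H[] // : bd K S p a.
apply/H1; rewrite E !inE !eqxx ?orbT; split=> //.
by move: U; rewrite /= !inE negb_or -andbA => /andP[].
Qed.

(** * The smallest disk with more than one face *)

Section Minimal.
Variables (S : complex) (t : {fset nat}).
Hypotheses (B : bounds K S t) (S2 : 1 < #|` S|).
Hypothesis minS : forall S' t', bounds K S' t' -> 1 < #|` S'| -> #|` S| <= #|` S'|.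
Let SK : S `<=` K. Proof. by case: B. Qed.
Let hS : pure S. Proof. by move=> f /(fsubsetP SK)/hK. Qed.
Let bdt : forall p q, bd K S p q <-> [/\ p != q, p \in t & q \in t].
Proof. by case: B. Qed.

(** Of the two sides of the 3-cycle, take the one that avoids a chosen face outside [S]. It lies
    inside [S], so by minimality it is a single face or [S] itself. *)
Lemma triangle_in_disk a b c : #|` [fset a; b; c]| = 3 ->
  [fset a; b] \in edges S -> [fset b; c] \in edges S -> [fset a; c] \in edges S ->
  fc S a b c \/ [fset a; b; c] = t.
Proof.
move=> t3 ab bc ac; set t1 := [fset a; b; c].
have eS p q : p \in t1 -> q \in t1 -> p != q -> [fset p; q] \in edges S.
  rewrite !inE => /orP[/orP[]|]/eqP-> /orP[/orP[]|]/eqP->; rewrite ?eqxx // => _ //;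
  by rewrite fsetUC.
have aK p q : p \in t1 -> q \in t1 -> p != q -> adj K p q.
  by move=> h1 h2 h3; apply: (fsubsetP (edges_sub tK SK)); apply: eS.
have [/fset0Pn[f0 f0C] _] := bounds_neq tK (bounds_compl B).
have f0K : f0 \in K by move: f0C; rewrite in_fsetD => /andP[].
have [S1 [B1 f01]] : exists S1, bounds K S1 t1 /\ f0 \notin S1.
  have [S1 B1] := jordan tK eK t3 aK.
  have [h|h] := boolP (f0 \in S1); last by exists S1.
  by exists (K `\` S1); split; [exact: bounds_compl|rewrite in_fsetD h].
have [S1K _ H1] := B1; have [S10 _] := bounds_neq tK B1.
have S1S : S1 `<=` S.
  rewrite -fsetD_eq0; apply/negPn/negP=> n.
  have BA : bounds K (S1 `\` S) t.
    apply: boundsI => //; first by case: B.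
    - exact: fsubset_trans (fsubsetDl _ _) S1K.
    - by apply: contraTneq f0K => <-; rewrite in_fsetD (negbTE f01) andbF.
    (* A boundary edge of the difference that is not visibly one of [S] is a side of [t1], hence an
       edge of [S]; it then has one face in [S] and one outside. *)
    - move=> p q h; suff /bdt[] : bd K S p q by [].
      case: h => s [r []]; rewrite !in_fsetD => h1 h2 /andP[sS sS1].
      rewrite negb_and negbK => /orP[rS|rS1]; first by exists r, s.
      have /H1[pq pt qt] : bd K S1 p q by exists s, r.
      have /(edgesP _ hS)[p' [q' [w [E pqw]]]] := eS _ _ pt qt pq; rewrite -E in pqw.
      by exists w, s; split=> //; apply: (fsubsetP SK).
  have sub : S1 `\` S `<=` K `\` S by apply: fsetSD.
  have e := bounds_sub tK (bounds_compl B) BA sub.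
  by move: f0C; rewrite -e in_fsetD (negbTE f01) andbF.
have [S12|S11] := ltnP 1 #|` S1|.
  right; have e : S1 = S by apply/eqP; rewrite eqEfcard S1S (minS B1 S12).
  by apply: (bounds_uniq B); rewrite -e.
left; have /cardfs1P[g gE] : #|` S1| == 1 by rewrite eqn_leq S11 cardfs_gt0.
have /and3P[nab nac nbc] : [&& a != b, a != c & b != c].
  by have /eqP := t3; rewrite card3 /= !inE negb_or andbT -andbA.
have /(bd_faces tK)[s [_ [h1 _ _ _ _]]] : bd K S1 a b.
  by apply/H1; rewrite /t1 !inE !eqxx ?orbT.
have /(bd_faces tK)[s' [_ [h2 _ _ _ _]]] : bd K S1 b c.
  by apply/H1; rewrite /t1 !inE !eqxx ?orbT.
apply: (fsubsetP S1S); have : c \in [fset a; b; s].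
  have /eqP -> : [fset a; b; s] == g by rewrite -in_fset1 -gE.
  have /eqP <- : [fset b; c; s'] == g by rewrite -in_fset1 -gE.
  by rewrite !inE eqxx orbT.
rewrite !inE (eq_sym c a) (eq_sym c b) (negbTE nac) (negbTE nbc) /= => /eqP cs.
by rewrite /t1 cs.
Qed.

Lemma disk_interior u p q : u \in vertices S -> u \notin t -> fc K u p q -> fc S u p q.
Proof.
case/(verticesP _ hS)=> a [b h] ut; apply: (star_all tK _ (fsubsetP SK _ h) h).
by move=> w /bdt[_ h' _]; rewrite h' in ut.
Qed.

Definition inner4 u := [/\ u \in vertices S, u \notin t & deg4 K u].

Section Separating.
Hypothesis tNK : t \notin K.

(** The face [abu] lies in [S] across a boundary edge, so [abv] does not. As [c] has the colour of
    [a], it is an inner vertex, and an edge [vc] would put [v] into [S]. Then either [v] is in [t],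
    so that [t = abv] is a face, or [v] is inner and [abv] lies in [S]. *)
Lemma link_edge_meets_boundary u a b c d v : inner4 u -> lk K u [:: a; b; c; d] ->
  a \in t -> b \in t -> fc K a b v -> v != u -> ~ adj K v c.
Proof.
move=> [uS ut _] l at_ bt abv vu vc; have [h1 h2 h3 h4] := lk4_faces l.
have [Ul _ _] := l; uniqF Ul.
have /(bd_faces tK)[s [r [k1 k2 k3 k4 E]]] : bd K S a b by apply/bdt.
have abu : fc S a b u by rewrite -(fset3B a u b) (fset3A a u b); apply: disk_interior.
have su : u = s.
  have : fc K a b u by apply: (fsubsetP SK).
  by rewrite E => /orP[/eqP //|/eqP e]; rewrite -e abu in k2.
have vr : v = r by move: abv; rewrite E -su (negbTE vu) => /eqP.
have cu : c \in vertices S.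
  apply/(verticesP _ hS); exists u, d; rewrite fset3A; exact: disk_interior.
have ct : c \notin t.
  apply/negP=> ct; have /(bd_faces tK)[w [_ [h _ _ _ _]]] : bd K S a c by apply/bdt.
  have := col_face tK hcol (fsubsetP SK _ h); rewrite (@col3 a b u c) ?eqxx //; fcp.
have vS : v \in vertices S.
  move: vc; rewrite adjC => /(adjP _ _ hK)[w /(disk_interior cu ct) h].
  by apply/(verticesP _ hS); exists c, w; rewrite fset3A.
have [ab av bv] := fc_neq hK abv.
case: (boolP (v \in t)) => vt.
  case/negP: tNK; suff -> : t = [fset a; b; v] by [].
  apply/esym/eqP; rewrite eqEfcard !fsubUset !fsub1set at_ bt vt /=.
  by have [_ -> _] := B; rewrite (hK abv).
have : fc K v a b by fcp.
by move/(disk_interior vS vt) => h; case/negP: k2; rewrite -vr; fcp.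
Qed.

Lemma inner4_link_boundary u a b c d : inner4 u -> lk K u [:: a; b; c; d] ->
  a \in t -> b \in t -> False.
Proof.
move=> Xu l at_ bt; have [h1 _ _ _] := lk4_faces l.
have abu : fc K a b u by fcp.
have [v vu E] := edge_faces tK abu.
have abv : fc K a b v by rewrite E eqxx orbT.
have [vc|vd] := blocked l abv vu.
  exact: link_edge_meets_boundary Xu l at_ bt abv vu vc.
by apply: link_edge_meets_boundary Xu (lk4_swap l) bt at_ _ vu vd; fcp.
Qed.

(** The 3-cycle [vbc] has its edges in [S] and is not [t], since [bc] is a link edge of [u]; hence
    it is a face and closes the link of [b]. All four faces at [b] then lie in [S], so no boundary
    edge ends at [b]. *)
Lemma inner4_next u a b c d v : inner4 u -> lk K u [:: a; b; c; d] ->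
  fc K a b v -> v != u -> adj K v c -> inner4 b.
Proof.
move=> Xu l abv vu vc; have [h1 h2 h3 h4] := lk4_faces l; have [uS ut _] := Xu.
have [Ul _ _] := l; uniqF Ul.
have abu : fc S a b u by rewrite -(fset3B a u b) (fset3A a u b); apply: disk_interior.
have abvS : fc S a b v.
  apply: (nbd (S := S) (K := K) _ (s := u)) => //; last by apply: (fsubsetP SK).
  by move=> /bdt[_ at_ bt]; apply: inner4_link_boundary Xu l at_ bt.
have bcuS : fc S b c u by rewrite (fset3B b c u) (fset3A b u c); apply: disk_interior.
have [r vcr] := (adjP v c hK).1 vc.
have vcS : [fset v; c] \in edges S.
  apply/(edgesP _ hS); exists v, c; have [vt|vt] := boolP (v \in t); last first.
    exists r; split=> //; apply: disk_interior => //.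
    by apply/(verticesP _ hS); exists a, b; fcp.
  have [ct|ct] := boolP (c \in t).
    have /(bd_faces tK)[w [_ [h _ _ _ _]]] : bd K S v c.
      by apply/bdt; have [] := fc_neq hK vcr.
    by exists w.
  exists r; split=> //; rewrite fset3A; apply: disk_interior => //.
    by apply/(verticesP _ hS); exists b, u; fcp.
  by fcp.
have vbS : [fset v; b] \in edges S.
  by apply/(edgesP _ hS); exists v, b, a; split=> //; fcp.
have bcS : [fset b; c] \in edges S by apply/(edgesP _ hS); exists b, c, u.
have [vc' _ _] := fc_neq hK vcr; have [_ av bv] := fc_neq hK abv.
have t3 : #|` [fset v; b; c]| = 3.
  by apply/eqP; rewrite card3 /= !inE negb_or; simpneq.
case: (triangle_in_disk t3 vbS bcS vcS) => [vbc|tE]; last first.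
  have lbc := lk_rot 1 l; rewrite /rot /= in lbc.
  by case: (inner4_link_boundary Xu lbc); rewrite -tE !inE !eqxx ?orbT.
have lb := deg4_next l abv vu (fsubsetP SK _ vbc).
have bS : b \in vertices S by apply/(verticesP _ hS); exists c, u.
split=> //; last by exists u, a, v, c.
apply/negP=> bt; have [_ t3' _] := B; have [w [w' [tE U']]] := card3_at t3' bt.
have /(bd_faces tK)[_ [r' [_ k1 k2 _ _]]] : bd K S b w.
  apply/bdt; rewrite tE !inE !eqxx ?orbT; split=> //.
  by move: U'; rewrite /= !inE negb_or -andbA => /andP[].
case/negP: k1; move: k2; have [_ _ ->] := lb.
rewrite /cedge /pairs /= !inE !xpair_eqE.
by case/orP=> /or4P[] /andP[/eqP-> /eqP->]; fcp.
Qed.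

Lemma inner4_cover u p q : inner4 u -> fc K u p q -> inner4 p \/ inner4 q.
Proof.
move=> Xu h; have [_ _ [a [b [c [d l0]]]]] := Xu.
have [c' [d' l]] := lk4_norm l0 h.
have pqu : fc K p q u by fcp.
have [v vu E] := edge_faces tK pqu.
have pqv : fc K p q v by rewrite E eqxx orbT.
have [vc|vd] := blocked l pqv vu; first by right; apply: inner4_next Xu l pqv vu vc.
by left; apply: inner4_next Xu (lk4_swap l) _ vu vd; fcp.
Qed.

(* The star of the inner vertices of degree 4 has no boundary, so it would be
   all of [K]; but it lies in the disk [S]. *)
Lemma no_separating_disk : False.
Proof.
have [A hA] := fset_sep K (fun f => exists2 u, u \in f & inner4 u).
have AK : A `<=` K by apply/fsubsetP=> f /hA[].
have [u] := interior_deg4 tK hcol B S2 eK; rewrite in_fsetD => /andP[ut uS] du.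
have Xu : inner4 u by [].
have [p [q upq]] := (verticesP u hS).1 uS.
have AE : A = K.
  apply: (dual_connected tK AK).
    apply/fset0Pn; exists [fset u; p; q]; apply/hA; split; first exact: (fsubsetP SK).
    by exists u => //; rewrite !inE eqxx.
  move=> x y [s [r [h1 h2 /hA[_ [w wf Xw]] /negP h4]]]; case: h4; apply/hA.
  split=> //; have [wx|wx] := boolP (w \in [fset x; y]).
    by exists w => //; rewrite in_fsetU wx.
  move: wf; rewrite in_fsetU (negbTE wx) inE => /eqP ws; rewrite ws in Xw.
  have sxy : fc K s x y by fcp.
  by case: (inner4_cover Xw sxy) => Xz; eexists; try exact: Xz; rewrite !inE eqxx ?orbT.
have [_ /negP] := bounds_neq tK B; apply; rewrite eqEfsubset SK.
apply/fsubsetP=> f fK; have : f \in A by rewrite AE.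
case/hA=> _ [w wf [wS wt _]]; have [a [b [fE _]]] := card3_at (hK fK) wf.
by rewrite fE in fK *; apply: disk_interior.
Qed.

End Separating.

Lemma disk_is_face_complement : t \in K.
Proof. by apply/negPn/negP; exact: no_separating_disk. Qed.

(** As a face, [t] lies outside [S] and is therefore the whole complement. So [S] contains every
    edge of [K], and [triangle_in_disk] covers every 3-cycle. *)
Lemma triangle_is_face a b c : #|` [fset a; b; c]| = 3 ->
  adj K a b -> adj K b c -> adj K a c -> fc K a b c.
Proof.
move=> t3 ab bc ac; have tKin := disk_is_face_complement.
have tC : t \in K `\` S.
  rewrite in_fsetD tKin andbT; apply: contraL S2 => /(bounds_face tK B)->.
  by rewrite cardfs1.
have CE := bounds_face tK (bounds_compl B) tC.
(* An edge has two faces, and only one face of [K] is missing from [S]. *)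
have eS p q : adj K p q -> [fset p; q] \in edges S.
  case/(adjP _ _ hK)=> s pqs; have [r rs E] := edge_faces tK pqs.
  have pqr : fc K p q r by rewrite E eqxx orbT.
  apply/(edgesP _ hS); exists p, q.
  case: (boolP (fc S p q s)) => [h|ns]; first by exists s.
  exists r; split=> //; apply/negPn/negP=> nr.
  have : fc (K `\` S) p q s by rewrite in_fsetD ns.
  have : fc (K `\` S) p q r by rewrite in_fsetD nr.
  rewrite CE !inE => /eqP<-; rewrite eq3; last exact: fc_uniq hK pqr.
  have [pq pr qr] := fc_neq hK pqr; have [_ ps qs] := fc_neq hK pqs.
  by simpneq; rewrite ?andbF.
case: (triangle_in_disk t3 (eS _ _ ab) (eS _ _ bc) (eS _ _ ac)) => [|-> //].
exact: (fsubsetP SK).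
Qed.

End Minimal.

(** * All 3-cycles are faces: bipyramids *)

Lemma deg4_exists : exists u, deg4 K u.
Proof.
have [S [t [B S2 _]]] := minimal_disk.
by have [u _ du] := interior_deg4 tK hcol B S2 eK; exists u.
Qed.

Lemma three_cycle_face a b c : #|` [fset a; b; c]| = 3 ->
  adj K a b -> adj K b c -> adj K a c -> fc K a b c.
Proof.
by have [S [t [B S2 m]]] := minimal_disk; apply: (triangle_is_face B S2 m).
Qed.

Lemma deg4_step u a b c d v : lk K u [:: a; b; c; d] ->
  fc K a b v -> v != u -> adj K v c -> deg4 K b.
Proof.
move=> l abv vu vc; have [h1 h2 h3 h4] := lk4_faces l.
have [r vcr] := (adjP v c hK).1 vc.
have [vc' _ _] := fc_neq hK vcr; have [_ av bv] := fc_neq hK abv.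
have [Ul _ _] := l; uniqF Ul.
exists u, a, v, c; apply: (deg4_next l abv vu); apply: three_cycle_face => //.
- by apply/eqP; rewrite card3 /= !inE negb_or; simpneq.
- by apply: (fc_adj (c := a) hK); fcp.
- by apply: (@fc_adj K b c u) => //; fcp.
Qed.

Lemma deg4_cover u p q : deg4 K u -> fc K u p q -> deg4 K p \/ deg4 K q.
Proof.
move=> [a [b [c [d l0]]]] h; have [c' [d' l]] := lk4_norm l0 h.
have pqu : fc K p q u by fcp.
have [v vu E] := edge_faces tK pqu.
have pqv : fc K p q v by rewrite E eqxx orbT.
have [vc|vd] := blocked l pqv vu; first by right; apply: deg4_step l pqv vu vc.
by left; apply: deg4_step (lk4_swap l) _ vu vd; fcp.
Qed.

(** The link of [q] is [c p a r]. If [r] did not have degree 4, the covering property at [q] would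
    give degree 4 to both [a] and [c]; closing up the links of [a], [p] and [c] then produces an
    octahedron, in which [r] has degree 4 after all. *)
Lemma rim_step a c p q r : a != c -> col a = col c -> p != r ->
  deg4 K p -> deg4 K q -> fc K a p q -> fc K a q r -> fc K c p q ->
  deg4 K r /\ fc K c q r.
Proof.
move=> ac cac pr dp dq apq aqr cpq.
have cr : c != r by apply: (@col_neq a r q) => //; fcp.
have lq : lk K q [:: c; p; a; r].
  by apply: deg4_closed dq _ _ _ _ pr; try fcp; rewrite eq_sym.
have [_ _ _ qrc] := lk4_faces lq.
split; last by fcp.
apply: NNPP => ndr.
have da : deg4 K a by case: (@deg4_cover q a r dq) => //; fcp.
have dc : deg4 K c by case: (@deg4_cover q r c dq) => //; fcp.
have [a1 [a2 [a3 [a4 la0]]]] := da.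
have [r' [m la]] := lk4_norm la0 apq.
have := lk_next r (lk_rot 1 la); rewrite /rot /= aqr (eq_sym r p) (negbTE pr) orbF.
move=> /esym/eqP rE; rewrite -rE in la.
have [_ _ arm amp] := lk4_faces la; have [Ua _ _] := la; uniqF Ua.
have cm : c != m by apply: col_neq amp _.
have lp : lk K p [:: c; q; a; m] by apply: deg4_closed dp _ _ _ _ _ => //; try fcp; rewrite eq_sym.
have [_ _ _ pmc] := lk4_faces lp.
have lc : lk K c [:: m; p; q; r].
  by apply: deg4_closed dc _ _ _ _ _ => //; try fcp; rewrite eq_sym.
have [_ _ _ crm] := lk4_faces lc.
apply: ndr; exists q, a, m, c; apply: tri_closed4 => //; fcp.
Qed.

(** Two adjacent vertices of degree 4 start the rim, their two common link vertices are the apexes,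
    and [rim_step] continues the rim both ways. The faces reached have no boundary, so they are all
    faces. *)
Theorem irreducible_bip : exists a c p,
  [/\ uniq (a :: c :: p), lk K a p, lk K c p & K = bip a c p].
Proof.
have [u du] := deg4_exists; have [a0 [b0 [c0 [d0 l0]]]] := du.
have [a [b [c [d [l db]]]]] : exists a b c d, lk K u [:: a; b; c; d] /\ deg4 K b.
  have [h1 _ _ _] := lk4_faces l0; case: (deg4_cover du h1) => [da|db].
    by exists d0, a0, b0, c0; split=> //; apply: (lk_rot 3 l0).
  by exists a0, b0, c0, d0.
have [h1 h2 h3 h4] := lk4_faces l; have [Ul _ _] := l; uniqF Ul.
have cac : col a = col c by apply: (@col3 a b u); fcp.
have [A hA] := fset_sep K (fun f => exists p q,
  [/\ deg4 K p, deg4 K q, fc K a p q, fc K c p q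
    & f = [fset a; p; q] \/ f = [fset c; p; q]]).
have AK : A `<=` K by apply/fsubsetP=> f /hA[].
have inA0 p q : deg4 K p -> deg4 K q -> fc K a p q -> fc K c p q ->
    fc A a p q /\ fc A c p q.
  move=> dp dq k1 k2; split; apply/hA; (split=> //; exists p, q; split=> //).
    by left.
  by right.
(* [e] is the apex of the face considered and [e'] the other one. Across a spoke the next face comes
   from [rim_step]; across the rim edge it is the face at [e']. *)
have step e e' p q x y s r : (e = a /\ e' = c) \/ (e = c /\ e' = a) ->
    deg4 K p -> deg4 K q -> fc K e p q -> fc K e' p q ->
    [fset x; y; s] = [fset e; p; q] -> fc K x y r -> fc A x y r.
  move=> ee dp dq epq e'pq E xyr.
  have nee : e != e' by case: ee => -[-> ->]; rewrite // eq_sym.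
  have cee : col e = col e' by case: ee => -[-> ->].
  have inA p' q' : deg4 K p' -> deg4 K q' -> fc K e p' q' -> fc K e' p' q' ->
      fc A e p' q' /\ fc A e' p' q'.
    by case: ee => -[-> ->] dp' dq' k1 k2; have [] := inA0 p' q'.
  have [[ep eq pq] [e'p e'q _]] := (fc_neq hK epq, fc_neq hK e'pq).
  have side p1 q1 : deg4 K p1 -> deg4 K q1 -> fc K e p1 q1 -> fc K e' p1 q1 ->
      forall r1, fc K e p1 r1 -> fc A e p1 r1.
    move=> dp1 dq1 k1 k2 r1 k3.
    have [<-|nqr] := eqVneq q1 r1; first by have [] := inA _ _ dp1 dq1 k1 k2.
    have [|||dr k4] := @rim_step e e' q1 p1 r1 nee cee nqr dq1 dp1; try fcp.
    by have [] := inA _ _ dp1 dr k3 k4.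
  have top r1 : fc K p q r1 -> fc A p q r1.
    have pqe : fc K p q e by fcp.
    have [e2 _ E2] := edge_faces tK pqe.
    have : fc K p q e' by fcp.
    rewrite !E2 (eq_sym e' e) (negbTE nee) /= => /eqP <-.
    have [k1 k2] := inA _ _ dp dq epq e'pq.
    by case/orP=> /eqP->; fcp.
  move/eqP: E; rewrite eq3; last exact: fc_uniq hK epq.
  have s1 := side p q dp dq epq e'pq r.
  have s2 : fc K e q r -> fc A e q r.
    by apply: (side q p) => //; fcp.
  have s3 := top r.
  have A3 k1 k2 k3 (L : complex) : fc L k1 k2 k3 -> fc L k2 k1 k3 by rewrite fset3A.
  case/or4P=> [||| /or3P[]] /and3P[/eqP xE /eqP yE _]; rewrite xE yE in xyr *.
  - exact: s1.
  - exact: s2.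
  - by apply/A3/s1/A3.
  - exact: s3.
  - by apply/A3/s2/A3.
  - by apply/A3/s3/A3.
have AE : A = K.
  apply: (dual_connected tK AK).
    apply/fset0Pn; exists [fset a; u; b]; apply/hA; split; first by fcp.
    by exists u, b; split=> //; [fcp|fcp|left].
  move=> x y [s [r [k1 k2 /hA[_ [p [q [dp dq apq cpq E]]]] /negP k4]]]; apply: k4.
  case: E => E.
    by apply: (step a c p q x y s r) => //; left.
  by apply: (step c a p q x y s r) => //; right.
have fcA p q : fc K a p q -> fc K c p q.
  rewrite -{1}AE => /hA[apq [p' [q' [_ _ apq' cpq' [E|E]]]]].
    move/eqP: E; rewrite eq3_at; last exact: fc_uniq hK apq'.
    by case/orP=> /andP[/eqP-> /eqP->] //; fcp.
  have : a \in [fset c; p'; q'] by rewrite -E !inE eqxx.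
  have [n1 n2 _] := fc_neq hK apq'.
  by rewrite !inE; simpneq.
have fcC p q : fc K c p q -> fc K a p q.
  rewrite -{1}AE => /hA[cpq [p' [q' [_ _ apq' cpq' [E|E]]]]]; last first.
    move/eqP: E; rewrite eq3_at; last exact: fc_uniq hK cpq'.
    by case/orP=> /andP[/eqP-> /eqP->] //; fcp.
  have : c \in [fset a; p'; q'] by rewrite -E !inE eqxx.
  have [n1 n2 _] := fc_neq hK cpq'.
  by rewrite !inE; simpneq.
have aub : fc K a u b by fcp.
have [p lp] := tri_lk tK aub; have [Up sz Ep] := lp.
have fcE p' q' : fc K c p' q' = fc K a p' q' by apply/idP/idP; [exact: fcC|exact: fcA].
have lc : lk K c p by split=> // p' q'; rewrite fcE Ep.
exists a, c, p; split=> //.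
  rewrite /= Up inE negb_or andbT; simpneq; apply/andP; split.
    by apply/negP=> /(lk_mem lp)[r /(fc_neq hK)[]]; rewrite eqxx.
  by apply/negP=> /(lk_mem lc)[r /(fc_neq hK)[]]; rewrite eqxx.
apply/fsetP=> f; rewrite /bip in_fsetU; apply/idP/orP.
  rewrite -{1}AE => /hA[_ [p' [q' [_ _ + _ E]]]]; rewrite Ep /cedge.
  case/orP=> k; case: E => ->; [left|right|left|right];
    apply/imfsetP; by [exists (p', q')|exists (q', p') => //=; rewrite fset3B].
by case=> /imfsetP[[p' q'] /= k ->]; rewrite ?fcE Ep /cedge k.
Qed.

End Irreducible.

(** * Equivalence under the moves *)

Definition contr (K L : complex) := triangulation K /\
  exists u v w x y z, contractible K u v w x y z /\ L = contract K u v w x y z.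

(** Symmetric closure supplies the splittings, so compatibility with relabelling has to be checked
    for contractions only. *)
Definition eqv := clos_refl_sym_trans complex contr.

Lemma contr_P_contraction K L : contr K L -> P_contraction K L.
Proof.
case=> tK [u [v [w [x [y [z [cK ->]]]]]]]; have tL := contract_tri tK cK.
have [U fs h5 nx ny] := cK; have hK := tri_pure tK.
exists u, v, w, x, y, z; split=> //; split=> //; last first.
  by split=> //; apply/eqP; uniqF U; rewrite eq_sym.
have E p q := contract_faces_at_u tK cK p q.
uniqF U; rewrite /degree.
have -> : [fset s in vertices K | adj K u s] = [fset w; x; y; z].
  apply/fsetP=> s; rewrite !inE /=; apply/andP/idP.
    case=> _ /(adjP _ _ hK)[r]; rewrite E /cedge /pairs /= !inE !xpair_eqE.
    by case/orP=> /or4P[] /andP[/eqP e1 /eqP e2]; rewrite ?e1 ?e2 !eqxx ?orbT.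
  have [h1 h2 h3 h4] := fs.
  case/orP=> [/orP[/orP[]|]|] /eqP->; (split; last by apply: fc_adj hK _; eassumption);
    apply/(verticesP _ hK).
  - by exists u, x; fcp.
  - by exists u, y; fcp.
  - by exists u, z; fcp.
  - by exists u, w; fcp.
by rewrite 3!cardfsU1r cardfs1 !inE; simpneq.
Qed.

Lemma contr_P_splitting K L : contr K L -> P_splitting L K.
Proof.
case=> tK [u [v [w [x [y [z [cK ->]]]]]]].
have [[f1 f2 f3] nwz] := contract_new_faces tK cK; have [U _ _ _ _] := cK.
exists u, v, w, x, y, z; split=> //; split=> //.
- by move: U => /= /and3P[_ _ ->].
- by rewrite (contract_vertices tK cK) !inE eqxx.
- by rewrite -{1}(contractK tK cK).
Qed.

Lemma eqv_P_moves K L : eqv K L -> clos_refl_trans complex P_move K L.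
Proof.
(* The induction over the symmetric closure needs both directions at once. *)
suff H : eqv K L ->
    clos_refl_trans complex P_move K L /\ clos_refl_trans complex P_move L K.
  by move/H=> [].
elim=> {K L} [K L h|K|K L _ [h1 h2]|K L M _ [h1 h2] _ [h3 h4]].
- by split; apply: rt_step; [right; apply: contr_P_contraction|left; apply: contr_P_splitting].
- by split; apply: rt_refl.
- by [].
- by split; [apply: rt_trans h1 h3|apply: rt_trans h4 h2].
Qed.

(** * Relabelling *)

Definition relabel (f : nat -> nat) (K : complex) : complex :=
  [fset (f @` s)%fset | s : {fset nat} in K].

Lemma imfset3 (f : nat -> nat) a b c : f @` [fset a; b; c] = [fset f a; f b; f c].
Proof. by rewrite !imfsetU !imfset_fset1. Qed.

Lemma relabelP f (K : complex) (s : {fset nat}) :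
  reflect (exists2 r, r \in K & s = f @` r) (s \in relabel f K).
Proof. exact: imfsetP. Qed.

Lemma relabel_eq f g (K : complex) : pure K -> {in vertices K, f =1 g} -> relabel f K = relabel g K.
Proof.
move=> hK h; have E s : s \in K -> f @` s = g @` s.
  move=> sK; have [a [b [c [sE _]]]] := card3P (hK _ sK); rewrite sE in sK *.
  rewrite !imfset3 !h //; apply/(verticesP _ hK);
    [exists a, b|exists a, c|exists b, c]; fcp.
by apply/fsetP=> s; apply/relabelP/relabelP=> -[r rK ->]; exists r; rewrite ?E.
Qed.

Lemma relabel_comp f g (K : complex) : relabel g (relabel f K) = relabel (g \o f) K.
Proof.
have E s : g @` (f @` s) = (g \o f) @` s by rewrite -imfset_comp.
apply/fsetP=> s; apply/relabelP/relabelP=> [[_ /relabelP[r rK ->] ->]|[r rK ->]].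
  by exists r; rewrite ?E.
by exists (f @` r); rewrite ?E //; apply/relabelP; exists r.
Qed.

Lemma relabel_id K : relabel id K = K.
Proof.
apply/fsetP=> s; apply/relabelP/idP=> [[r rK ->]|sK]; first by rewrite imfset_id.
by exists s; rewrite ?imfset_id.
Qed.

(** Injectivity on all naturals, not just on [s], lets one relabelling act on a whole chain of
    moves, including the new vertices of splittings. *)
Lemma extend_injection (s s' : seq nat) : uniq s -> uniq s' -> size s = size s' ->
  exists2 f : nat -> nat, injective f & map f s = s'.
Proof.
move=> Us Us' sz; pose M := (\max_(i <- s') i).+1.
(* Entries outside [s] are shifted beyond the maximum of [s'], away from all prescribed values. *)
pose f n := if n \in s then nth 0 s' (index n s) else (n + M)%N.
have small n : n \in s -> nth 0 s' (index n s) < M.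
  move=> ns; rewrite ltnS; apply: leq_bigmax_seq => //.
  by rewrite mem_nth // -sz index_mem.
exists f.
  move=> x y; rewrite /f; case: ifP => xs; case: ifP => ys.
  - move/eqP; rewrite nth_uniq -?sz ?index_mem // => /eqP e.
    by rewrite -(nth_index 0 xs) e nth_index.
  - by have := small _ xs; lia.
  - by have := small _ ys; lia.
  - lia.
apply: (@eq_from_nth _ 0); rewrite size_map // => i ilt.
by rewrite (nth_map 0) // /f mem_nth // index_uniq.
Qed.

Lemma isomorphic_relabel K L : pure K -> isomorphic K L ->
  exists2 f, injective f & L = relabel f K.
Proof.
move=> hK [f [inj ->]].
have [|||g gi gE] := @extend_injection (vertices K) (map f (vertices K)).
- exact: fset_uniq.
- by rewrite map_inj_in_uniq ?fset_uniq.
- by rewrite size_map.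
exists g => //; apply: relabel_eq => // x xK.
by have /eq_in_map := gE; move/(_ x xK) => ->.
Qed.

Lemma relabel_isomorphic f K : injective f -> pure K -> isomorphic (relabel f K) K.
Proof.
move=> fi hK.
have [|||g gi gE] := @extend_injection (map f (vertices K)) (vertices K).
- by rewrite map_inj_uniq ?fset_uniq.
- exact: fset_uniq.
- by rewrite size_map.
exists g; split; first by move=> x y _ _; apply: gi.
rewrite -/(relabel g _) relabel_comp -{1}(relabel_id K); apply: relabel_eq => // x xK.
move: gE; rewrite -map_comp -{2}(map_id (vertices K)) => /eq_in_map/(_ x xK) /= ->.
by [].
Qed.

Section Relabel.
Variable f : nat -> nat.
Hypothesis fi : injective f.

Lemma imfset_inj : injective (fun s : {fset nat} => f @` s).
Proof.
move=> s t /= e; apply/fsetP=> x; apply/idP/idP=> h.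
  have : f x \in f @` t by rewrite -e; apply: in_imfset.
  by case/imfsetP=> y /= yt /fi->.
have : f x \in f @` s by rewrite e; apply: in_imfset.
by case/imfsetP=> y /= yt /fi->.
Qed.

Lemma relabel_fc (K : complex) a b c : fc (relabel f K) (f a) (f b) (f c) = fc K a b c.
Proof.
rewrite -imfset3; apply/relabelP/idP=> [[r rK /imfset_inj->] //|h].
by exists [fset a; b; c].
Qed.

Lemma relabel_fc_inv (K : complex) p q r : pure K -> fc (relabel f K) p q r ->
  exists a b c, [/\ p = f a, q = f b, r = f c & fc K a b c].
Proof.
move=> hK h; have mem s : s \in [fset p; q; r] -> exists a, s = f a.
  by case/relabelP: h => t _ -> /imfsetP[a _ ->]; exists a.
have [a pa] : exists a, p = f a by apply: mem; rewrite !inE eqxx.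
have [b qb] : exists b, q = f b by apply: mem; rewrite !inE eqxx orbT.
have [c rc] : exists c, r = f c by apply: mem; rewrite !inE eqxx orbT.
by exists a, b, c; split=> //; move: h; rewrite pa qb rc relabel_fc.
Qed.

Lemma relabel_pure K : pure K -> pure (relabel f K).
Proof.
move=> hK s /relabelP[r rK ->]; rewrite -(hK _ rK).
by apply: card_in_imfset => x y _ _; apply: fi.
Qed.

Lemma relabel_adj K a b : pure K -> adj (relabel f K) (f a) (f b) = adj K a b.
Proof.
move=> hK; have hL := relabel_pure hK; apply/idP/idP.
  case/(adjP _ _ hL)=> r /(relabel_fc_inv hK)[a' [b' [c [/fi-> /fi-> _ h]]]].
  exact: fc_adj h.
by case/(adjP _ _ hK)=> r h; apply: (@fc_adj _ _ _ (f r)) => //; rewrite relabel_fc.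
Qed.

Lemma pairs_map c : pairs (map f c) = [seq (f e.1, f e.2) | e <- pairs c].
Proof.
rewrite /pairs -map_rot; elim: c (rot 1 c) => [|x s IH] [|y t] //=.
by rewrite IH.
Qed.

Lemma mem_pairs_map c p q : (f p, f q) \in pairs (map f c) = ((p, q) \in pairs c).
Proof.
rewrite pairs_map; apply/mapP/idP=> [[[a b] h [/fi-> /fi->]] //|h].
by exists (p, q).
Qed.

Lemma relabel_lk K v c : pure K -> lk K v c -> lk (relabel f K) (f v) (map f c).
Proof.
move=> hK [U sz E]; split; rewrite ?map_inj_uniq ?size_map // => p q.
apply/idP/idP.
  case/(relabel_fc_inv hK)=> a [b [d [/fi va -> ->]]]; rewrite -va E /cedge.
  by rewrite !mem_pairs_map.
rewrite /cedge !pairs_map => /orP[]/mapP[[a b] h [-> ->]] /=; rewrite relabel_fc E /cedge h //.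
by rewrite orbT.
Qed.

Lemma relabel_tri K : triangulation K -> triangulation (relabel f K).
Proof.
move=> tK; have hK := tri_pure tK; have hL := relabel_pure hK.
apply: triI => //.
- have [/fset0Pn[s sK] _ _ _] := tK.
  by apply/fset0Pn; exists (f @` s); apply/relabelP; exists s.
- move=> v a b /(relabel_fc_inv hK)[v' [a' [b' [-> _ _ h]]]].
  by have [c lc] := tri_lk tK h; exists (map f c); apply: relabel_lk.
- apply: (@connected_map K _ f); first by case: tK.
    move=> x /(verticesP _ hL)[a [b /(relabel_fc_inv hK)[x' [a' [b' [-> _ _ h]]]]]].
    by exists x'; [apply/(verticesP _ hK); exists a', b'|exact: reach_refl].
  by move=> x y xy; apply: reach_adj; rewrite relabel_adj.
Qed.

Lemma relabelU (A B : complex) : relabel f (A `|` B) = relabel f A `|` relabel f B.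
Proof. exact: imfsetU. Qed.

Lemma relabelD (A B : complex) : relabel f (A `\` B) = relabel f A `\` relabel f B.
Proof.
apply/fsetP=> s; rewrite in_fsetD; apply/relabelP/andP.
  case=> r; rewrite in_fsetD => /andP[rB rA] ->; split; last by apply/relabelP; exists r.
  by apply/relabelP=> -[r' rB' /imfset_inj e]; rewrite e rB' in rB.
case=> sB /relabelP[r rA sE]; exists r => //; rewrite in_fsetD rA andbT.
by apply: contra sB => rB; apply/relabelP; exists r.
Qed.

Lemma relabel1 a b c : relabel f [fset [fset a; b; c]] = [fset [fset f a; f b; f c]].
Proof. by rewrite -imfset3; apply: imfset_fset1. Qed.

Lemma relabel_contract K u v w x y z : relabel f (contract K u v w x y z) =
  contract (relabel f K) (f u) (f v) (f w) (f x) (f y) (f z).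
Proof. by rewrite /contract !(relabelU, relabelD, relabel1). Qed.

Lemma relabel_contr K L : contr K L -> contr (relabel f K) (relabel f L).
Proof.
case=> tK [u [v [w [x [y [z [cK ->]]]]]]]; split; first exact: relabel_tri.
exists (f u), (f v), (f w), (f x), (f y), (f z); rewrite relabel_contract; split=> //.
have hK := tri_pure tK; case: cK => U fs h nx ny.
split; rewrite ?relabel_fc ?relabel_adj //.
by rewrite -(map_inj_uniq fi) in U.
Qed.

Lemma relabel_eqv K L : eqv K L -> eqv (relabel f K) (relabel f L).
Proof.
elim=> {K L} [K L h|K|K L _ h|K L M _ h1 _ h2].
- by apply: rst_step; apply: relabel_contr.
- exact: rst_refl.
- exact: rst_sym.
- exact: rst_trans h1 h2.
Qed.

Lemma relabel_bip a c p : relabel f (bip a c p) = bip (f a) (f c) (map f p).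
Proof.
have E d : relabel f [fset [fset d; e.1; e.2] | e in pairs p] =
    [fset [fset f d; e.1; e.2] | e in pairs (map f p)].
  rewrite pairs_map; apply/fsetP=> s; apply/relabelP/imfsetP.
    case=> _ /imfsetP[e ep ->] ->; exists (f e.1, f e.2); rewrite ?imfset3 //.
    by apply/mapP; exists e.
  case=> _ /mapP[e ep ->] ->; exists [fset d; e.1; e.2]; rewrite ?imfset3 //.
  by apply/imfsetP; exists e.
by rewrite /bip relabelU !E.
Qed.
End Relabel.

(** * The octahedron *)

(** Antipodal labels are congruent modulo 3, and a face takes one vertex from each antipodal
    pair. *)
Lemma octahedral_faceE a b c : fc octahedral_sphere a b c =
  [&& a < 6, b < 6, c < 6 & uniq [:: a %% 3; b %% 3; c %% 3]].
Proof.
rewrite /octahedral_sphere !inE !eq3 //.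
by case: a => [|[|[|[|[|[|a]]]]]]; case: b => [|[|[|[|[|[|b]]]]]];
  case: c => [|[|[|[|[|[|c]]]]]].
Qed.

Lemma mem_bip a c p f : (f \in bip a c p) =
  has (fun e => f == [fset a; e.1; e.2]) (pairs p) ||
  has (fun e => f == [fset c; e.1; e.2]) (pairs p).
Proof.
rewrite /bip in_fsetU; congr orb; apply/imfsetP/hasP=> -[e ep h]; exists e => //; exact/eqP.
Qed.

Lemma octahedral_bip : octahedral_sphere = bip 0 3 [:: 1; 2; 4; 5].
Proof.
apply/fsetP=> f; rewrite mem_bip /= !inE (fset3B 0 4 2) (fset3B 3 4 2).
by rewrite (fset3B 0 1 5) (fset3B 3 1 5); boolcases.
Qed.

Lemma bip_relabel a c p a' c' p' : uniq [:: a, c & p] -> uniq [:: a', c' & p'] ->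
  size p = size p' -> exists2 f, injective f & relabel f (bip a c p) = bip a' c' p'.
Proof.
move=> U U' sz; have [|f fi [ea ec ep]] := extend_injection U U'; first by rewrite /= sz.
by exists f; rewrite // relabel_bip // ea ec ep.
Qed.

Lemma bip4_octahedral a c p : uniq [:: a, c & p] -> size p = 4 ->
  isomorphic (bip a c p) octahedral_sphere.
Proof.
move=> U sz; rewrite octahedral_bip.
have [||f fi <-] := @bip_relabel _ _ _ 0 3 [:: 1; 2; 4; 5] U; rewrite ?sz //.
by exists f; split=> // x y _ _; apply: fi.
Qed.

(* A P-splitting needs a vertex of degree at least 6. *)
Lemma contract_not_octahedral K u v w x y z : triangulation K ->
  contractible K u v w x y z -> ~ isomorphic (contract K u v w x y z) octahedral_sphere.
Proof.
move=> tK cK; have hL := contract_pure tK cK.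
have [[f1 f2 f3] /negP nwz] := contract_new_faces tK cK.
case/(isomorphic_relabel hL)=> f fi E; apply: nwz.
move: f1 f2 f3; rewrite -(relabel_fc fi _ v w) -(relabel_fc fi _ v x).
rewrite -(relabel_fc fi _ v y) -E !octahedral_faceE.
case/and4P=> vl wl _ U1 /and4P[_ _ _ U2] /and4P[_ _ zl U3].
apply: (@fc_adj _ _ _ v) => //; rewrite fset3B fset3A -(relabel_fc fi) -E octahedral_faceE.
(* The classes of [w], [x], [y], [z] modulo 3 alternate between the two that differ from the class
   of [v]; hence [vwz] would be a face and [wz] an edge. *)
rewrite vl wl zl /=; have lt3 n : n %% 3 < 3 by rewrite ltn_mod.
move: U1 U2 U3 (lt3 (f v)) (lt3 (f w)) (lt3 (f x)) (lt3 (f y)) (lt3 (f z)).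
move: (f v %% 3) (f w %% 3) (f x %% 3) (f y %% 3) (f z %% 3).
by move=> [|[|[|?]]] [|[|[|?]]] [|[|[|?]]] [|[|[|?]]] [|[|[|?]]].
Qed.

Lemma fresh (V : {fset nat}) : exists u, u \notin V.
Proof.
exists (\max_(v <- V) v).+1; apply/negP=> h.
have : (\max_(v <- V) v).+1 <= \max_(v <- V) v by apply: (@leq_bigmax_seq _ _ xpredT id).
by rewrite ltnn.
Qed.

(** * Shortening a bipyramid over a long cycle *)

Section BipMoves.
Variables (K : complex) (a c p1 p2 p3 p4 p5 p6 q : nat) (s : seq nat).
Let p := [:: p1, p2, p3, p4, p5, p6 & rcons s q].
Hypotheses (tK : triangulation K) (U : uniq [:: a, c & p]).
Hypotheses (la : lk K a p) (lc : lk K c p).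
Let hK := tri_pure tK.

Lemma rim_lk x y z : (x, y) \in pairs p -> (y, z) \in pairs p -> x != z ->
  lk K y [:: x; a; z; c].
Proof.
move=> xy yz xz; have [_ _ Ea] := la; have [_ _ Ec] := lc.
have f1 : fc K a x y by rewrite Ea /cedge xy.
have f2 : fc K a y z by rewrite Ea /cedge yz.
have f3 : fc K c x y by rewrite Ec /cedge xy.
have f4 : fc K c y z by rewrite Ec /cedge yz.
apply: tri_closed4 => //; try fcp.
by move: U => /= /andP[]; rewrite inE negb_or => /andP[].
Qed.

(** The splitting detaches [p2] and [p3] from [a]. Hence [p5] can be contracted towards [p3], which
    restores the edge [p3 a] and adds [p3 p6]; then [p2], with link [p1 u p3 c], can be contracted
    towards [q]. The last step needs [q] not adjacent to [p3], hence [q] different from [p6]: this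
    is where the seventh rim vertex is used. *)
Lemma bip_moves u : u \notin vertices K ->
  let K1 := split_at K u a p1 p2 p3 p4 in
  let K2 := contract K1 p5 p3 p4 a p6 c in
  [/\ splittable K u a p1 p2 p3 p4, contractible K1 p5 p3 p4 a p6 c
    & contractible K2 p2 q p1 u p3 c].
Proof.
move=> uK K1 K2.
have ap d x y : lk K d p -> (x, y) \in pairs p -> fc K d x y.
  by case=> _ _ E h; rewrite E /cedge h.
have pE : pairs p =
    [:: (p1, p2); (p2, p3); (p3, p4); (p4, p5); (p5, p6)] ++ arc_pairs p6 (rcons s q) p1.
  by rewrite /p pairs_cons !arc_cons.
have U' : uniq [:: a, c, p1, p2, p3, p4, p5, p6 & rcons s q] := U.
have qp1 : (q, p1) \in pairs p.
  rewrite pE mem_cat; apply/orP; right; rewrite arc_last ?last_rcons //.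
  by uniqF U'; rewrite rcons_uniq; apply/andP.
have i12 : (p1, p2) \in pairs p by rewrite pE !inE eqxx ?orbT.
have i23 : (p2, p3) \in pairs p by rewrite pE !inE eqxx ?orbT.
have i34 : (p3, p4) \in pairs p by rewrite pE !inE eqxx ?orbT.
have i45 : (p4, p5) \in pairs p by rewrite pE !inE eqxx ?orbT.
have i56 : (p5, p6) \in pairs p by rewrite pE !inE eqxx ?orbT.
have uE r : r \in vertices K -> u != r by apply: contraTneq => <-.
have nu x y : fc K u x y = false.
  by apply/negbTE; apply: contra uK => h; apply/(verticesP _ hK); exists x, y.
have vp d x y : lk K d p -> (x, y) \in pairs p -> [/\ u != d, u != x & u != y].
  move=> ld h; have h' := ap _ _ _ ld h.
  by split; apply: uE; apply/(verticesP _ hK); [exists x, y|exists d, y|exists d, x]; fcp.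
have U9 : uniq [:: u; a; c; p1; p2; p3; p4; p5; p6; q].
  have sub : uniq [:: a; c; p1; p2; p3; p4; p5; p6; q].
    apply: subseq_uniq U; rewrite /p /= !eqxx.
    by rewrite sub1seq mem_rcons mem_head.
  rewrite cons_uniq sub andbT !inE !negb_or.
  have [-> -> _] := vp _ _ _ la qp1; have [-> -> ->] := vp _ _ _ lc i12.
  by have [_ -> ->] := vp _ _ _ lc i34; have [_ -> ->] := vp _ _ _ lc i56.
have l1 : lk K p1 [:: q; a; p2; c] by apply: rim_lk => //; uniqF U9; rewrite eq_sym.
have l3 : lk K p3 [:: p2; a; p4; c] by apply: rim_lk => //; uniqF U9.
have a12 := ap _ _ _ la i12; have a23 := ap _ _ _ la i23; have a34 := ap _ _ _ la i34.
have a45 := ap _ _ _ la i45; have a56 := ap _ _ _ la i56; have aq1 := ap _ _ _ la qp1.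
have c12 := ap _ _ _ lc i12; have c23 := ap _ _ _ lc i23; have c34 := ap _ _ _ lc i34.
have c45 := ap _ _ _ lc i45; have c56 := ap _ _ _ lc i56; have cq1 := ap _ _ _ lc qp1.
clear i12 i23 i34 i45 i56 qp1 pE.
have sK : splittable K u a p1 p2 p3 p4.
  uniqF U9; split=> //; first by rewrite /= !inE !negb_or; simpneq.
  apply/negP=> /(adjP _ _ hK)[t]; have [_ _ ->] := l1.
  by rewrite /cedge /pairs /= !inE !xpair_eqE; simpneq; rewrite ?andbF.
have t1 := split_tri tK sK; have h1 := tri_pure t1.
have s1 : contractible K1 p5 p3 p4 a p6 c.
  uniqF U9; split=> //; first by rewrite /= !inE !negb_or; simpneq.
  - by split; rewrite /K1 /split_at; fcE; fcp.
  - by rewrite /K1 /split_at; fcE; fcp.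
  - apply/negP=> /(adjP _ _ h1)[t]; rewrite /K1 /split_at; fcE.
    have [_ _ ->] := l3; rewrite /cedge /pairs /= !inE !xpair_eqE; simpneq.
    by boolcases.
  - apply/negP=> /(adjP _ _ h1)[t]; rewrite /K1 /split_at; fcE.
    have [_ _ ->] := l3; rewrite /cedge /pairs /= !inE !xpair_eqE; simpneq.
    by boolcases.
have t2 := contract_tri t1 s1; have h2 := tri_pure t2.
split=> //; uniqF U9; split=> //; first by rewrite /= !inE !negb_or; simpneq.
- by split; rewrite /K2 /contract /K1 /split_at; fcE; rewrite ?eqxx ?orbT //; fcp.
- by rewrite /K2 /contract /K1 /split_at; fcE; fcp.
- apply/negP=> /(adjP _ _ h2)[t]; rewrite /K2 /contract /K1 /split_at; fcE.
  by rewrite (fset3A q u) nu.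
- apply/negP=> /(adjP _ _ h2)[t]; rewrite /K2 /contract /K1 /split_at; fcE.
  rewrite (fset3A q p3).
  have [_ _ ->] := l3; rewrite /cedge /pairs /= !inE !xpair_eqE; simpneq.
  by boolcases.
Qed.
End BipMoves.

Lemma contract_sphere K u v w x y z : sphere_triangulation K ->
  contractible K u v w x y z -> sphere_triangulation (contract K u v w x y z).
Proof.
case=> tK eK cK; have tL := contract_tri tK cK; split=> //; apply/(sphere_count tL).
have /(sphere_count tK) := eK.
have := contract_card_faces tK cK; have := contract_card_vertices tK cK; lia.
Qed.

Lemma split_sphere K u v w x y z : sphere_triangulation K ->
  splittable K u v w x y z -> sphere_triangulation (split_at K u v w x y z).
Proof.
case=> tK eK sK; have tL := split_tri tK sK; split=> //; apply/(sphere_count tL).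
have cL := split_contractible tK sK; have /(sphere_count tK) := eK.
have := contract_card_faces tL cL; have := contract_card_vertices tL cL.
rewrite (splitK tK sK); lia.
Qed.

Lemma reduce_large_bip K a c p : sphere_triangulation K -> balanced K ->
  uniq [:: a, c & p] -> lk K a p -> lk K c p -> 6 < size p ->
  exists L, [/\ eqv K L, sphere_triangulation L, balanced L,
    #|` vertices L| < #|` vertices K| & ~ isomorphic L octahedral_sphere].
Proof.
move=> sK bK U la lc sz; have [tK _] := sK.
case: p U la lc sz => [|p1 [|p2 [|p3 [|p4 [|p5 [|p6 p]]]]]] //.
case/lastP: p => // s q U la lc _.
have [u uK] := fresh (vertices K).
have [sp c1 c2] := bip_moves tK U la lc uK.
set K1 := split_at _ _ _ _ _ _ _ in c1 c2; set K2 := contract K1 _ _ _ _ _ _ in c2.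
have s1 : sphere_triangulation K1 := split_sphere sK sp.
have s2 : sphere_triangulation K2 := contract_sphere s1 c1.
have [t1 _] := s1; have [t2 _] := s2.
exists (contract K2 p2 q p1 u p3 c); split.
- apply: rst_trans (rst_trans _ _ _ K1 K2 _ _) (rst_step _ _ _ _ _).
  (* The splitting is the reverse of the contraction from [K1] back to [K]. *)
  + apply: rst_sym; apply: rst_step; split=> //.
    exists u, a, p1, p2, p3, p4; rewrite (splitK tK sp); split=> //.
    exact: split_contractible.
  + by apply: rst_step; split=> //; exists p5, p3, p4, a, p6, c.
  + by split=> //; exists p2, q, p1, u, p3, c.
- exact: contract_sphere.
- apply: contract_balanced => //; apply: contract_balanced => //.
  exact: split_balanced.
- have := contract_card_vertices t1 (split_contractible tK sp).
  have := contract_card_vertices t1 c1; have := contract_card_vertices t2 c2.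
  rewrite (splitK tK sp) -/K2; lia.
- exact: contract_not_octahedral.
Qed.

(** The induction hypothesis applies after each reduction because a contraction never produces the
    octahedron; that is why reductions of large bipyramids also end with a contraction. *)
Lemma reduce_to_hexagonal K : sphere_triangulation K -> balanced K ->
  ~ isomorphic K octahedral_sphere ->
  exists a c p, [/\ uniq [:: a, c & p], size p = 6 & eqv K (bip a c p)].
Proof.
have [n] := ubnP #|` vertices K|; elim: n K => // n IH K ltn sK bK oK.
have [tK eK] := sK.
case: (classic (exists u v w x y z, contractible K u v w x y z)).
  case=> u [v [w [x [y [z cK]]]]].
  have [||||a [c [p [U sz e]]]] := IH (contract K u v w x y z).
  - by have := contract_card_vertices tK cK; lia.
  - exact: contract_sphere.
  - exact: contract_balanced.
  - exact: contract_not_octahedral.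
  exists a, c, p; split=> //; apply: rst_trans e; apply: rst_step; split=> //.
  by exists u, v, w, x, y, z.
move=> irr; have [col hcol] := bK.
have [|a [c [p [U la lc KE]]]] := irreducible_bip tK eK hcol.
  by move=> u v w x y z h; apply: irr; exists u, v, w, x, y, z.
have ev := lk_even tK hcol la; have [_ sz3 _] := la.
have n4 : size p <> 4 by move=> p4; apply: oK; rewrite KE; apply: bip4_octahedral.
have [p6|p6] := eqVneq (size p) 6.
  by exists a, c, p; split=> //; rewrite -KE; apply: rst_refl.
have [|L [e sL bL ltL oL]] := @reduce_large_bip K a c p sK bK U la lc.
  (* An even length of at least 3 that is neither 4 nor 6 exceeds 6. *)
  by move: ev sz3 n4 p6; case: (size p) => [|[|[|[|[|[|[|m]]]]]]].
have [|a' [c' [p' [U' sz' e']]]] := IH L _ sL bL oL.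
  by apply: leq_trans ltL _.
by exists a', c', p'; split=> //; apply: rst_trans e e'.
Qed.

Theorem theorem1p3 (K L : complex)
  (hK : sphere_triangulation K) (bK : balanced K)
  (hL : sphere_triangulation L) (bL : balanced L)
  (oK : ~ isomorphic K octahedral_sphere)
  (oL : ~ isomorphic L octahedral_sphere) :
  P_equivalent K L.
Proof.
have [a [c [p [U sz e]]]] := reduce_to_hexagonal hK bK oK.
have [a' [c' [p' [U' sz' e']]]] := reduce_to_hexagonal hL bL oL.
have [|f fi fE] := bip_relabel U' U; first by rewrite sz sz'.
(* [f] carries the hexagonal bipyramid reached from [L] onto the one reached from [K]. Relabelling
   the whole chain of moves from [L] lets the two chains meet, and the copy of [L] is isomorphic to
   [L]. *)
exists (relabel f L).
  apply: eqv_P_moves; apply: rst_trans e _; apply: rst_sym.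
  by rewrite -fE; apply: relabel_eqv.
by apply: relabel_isomorphic => //; case: hL => /tri_pure.
Qed.
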